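(* Let $X=(X_t)_{t\ge0}$ be a real L\'evy process with no Gaussian component ($\sigma^2=0$), and, if $X$ is of bounded variation ($X\in bv$), assume it has drift zero. Suppose that $\limsup_{t\downarrow0}|X_t|/t^\kappa=\infty$ a.s. for some $\kappa\ge1/2$. Then, for this $\kappa$, $$\limsup_{t\downarrow0}\frac{|X_t-a(t)|}{t^\kappa}=\infty\quad\text{a.s.}$$ for every nonstochastic function $a(t)$.
   Context: The L\'evy process $X$ ($X_0=0$) has characteristic triplet $(\gamma,\sigma^2,\Pi)$ with $\sigma^2=0$, $\gamma\in\mathbb{R}$, and the L\'evy measure $\Pi$ is carried by $[-1,1]\setminus\{0\}$ with $\int x^2\,\Pi(dx)<\infty$; that is, $E[e^{i\theta X_t}]=e^{t\Psi(\theta)}$ with $$\Psi(\theta)=i\gamma\theta+\int_{[-1,1]}(e^{i\theta x}-1-i\theta x)\,\Pi(dx),\quad \theta\in\mathbb{R}.$$ $X\in bv$ if and only if $\int_{|x|\le1}|x|\,\Pi(dx)<\infty$ (given $\sigma^2=0$), and then the drift is $\delta=\gamma-\int_{[-1,1]}x\,\Pi(dx)$. *)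

(* Defs.v *)
From HB Require Import structures.
From mathcomp Require Import all_boot all_order all_algebra complex.
From mathcomp Require Import all_classical all_reals all_analysis.

Set Implicit Arguments.
Unset Strict Implicit.
Unset Printing Implicit Defensive.

Import Order.TTheory GRing.Theory Num.Theory.
Import numFieldNormedType.Exports.
Local Open Scope classical_set_scope.
Local Open Scope complex_scope.
Local Open Scope ring_scope.

Definition cexp (R : realType) (z : R[i]) : R[i] :=
  (expR (complex.Re z))%:C *
  (cos (complex.Im z) +i* sin (complex.Im z)).

(* Integral of a complex-valued function, by real and imaginary parts; like
   Rintegral, it is meaningful only for integrable functions. *)
Definition Cintegral (d : measure_display) (T : measurableType d)
    (R : realType) (mu : {measure set T -> \bar R}) (D : set T)
    (f : T -> R[i]) : R[i] :=
  Rintegral mu D (fun x => complex.Re (f x)) +i*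
  Rintegral mu D (fun x => complex.Im (f x)).

Definition char_fun (d : measure_display) (T : measurableType d)
    (R : realType) (P : probability T R) (Y : T -> R) (theta : R) : R[i] :=
  Cintegral P setT (fun w => cexp (0 +i* (theta * Y w))).

(* The product rule over proper subfamilies is the case B i = setT for the
   remaining indices. *)
Definition mutually_independent (d : measure_display) (T : measurableType d)
    (R : realType) (P : probability T R) (I : finType) (Y : I -> T -> R)
    : Prop :=
  forall B : I -> set R, (forall i, measurable (B i)) ->
  P (\bigcap_(i in [set: I]) (Y i @^-1` B i)) =
  (\prod_(i : I) P (Y i @^-1` B i))%E.

(* Time is the nonnegative half of R: the values of X and of a path at
   negative times are unconstrained and never used. *)
Definition cadlag (R : realType) (x : R -> R) : Prop :=
  (forall t, 0 <= t -> x s @[s --> t^'+] --> x t) /\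
  (forall t, 0 < t -> cvg (x s @[s --> t^'-])).

Record levy_process (d : measure_display) (T : measurableType d)
    (R : realType) (P : probability T R) (X : R -> {RV P >-> R}) : Prop := {
  levy_start0 : {ae P, forall w, X 0 w = 0};
  levy_indep : forall (n : nat) (t : nat -> R),
    0 <= t 0%N -> (forall i, t i <= t i.+1) ->
    mutually_independent P (fun (i : 'I_n) w => X (t i.+1) w - X (t i) w);
  levy_stationary : forall s t : R, 0 <= s -> s <= t ->
    forall B : set R, measurable B ->
    P ((fun w => X t w - X s w) @^-1` B) = P (X (t - s) @^-1` B);
  levy_cadlag : {ae P, forall w, cadlag (fun t => X t w)} }.

Definition bv_process (d : measure_display) (T : measurableType d)
    (R : realType) (P : probability T R) (X : R -> {RV P >-> R}) : Prop :=
  {ae P, forall w, forall t : R, 0 <= t ->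
    bounded_variation 0 t (fun s => X s w)}.

Definition unit_levy_measure (R : realType)
    (Pi : {measure set (measurableTypeR R) -> \bar R}) : Prop :=
  Pi (~` (`[-1, 1] `\ 0)) = 0%E /\ (\int[Pi]_x (x ^+ 2)%:E < +oo)%E.

Definition levy_exponent (R : realType) (gamma sigma2 : R)
    (Pi : {measure set (measurableTypeR R) -> \bar R}) (theta : R) : R[i] :=
  0 +i* (gamma * theta) - (sigma2 * theta ^+ 2 / 2)%:C +
  Cintegral Pi `[-1, 1]
    (fun x : R => cexp (0 +i* (theta * x)) - 1 - (0 +i* (theta * x))).

Definition has_triplet (d : measure_display) (T : measurableType d)
    (R : realType) (P : probability T R) (X : R -> {RV P >-> R})
    (gamma sigma2 : R) (Pi : {measure set (measurableTypeR R) -> \bar R})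
    : Prop :=
  forall t theta : R, 0 <= t ->
  char_fun P (X t) theta = cexp (t%:C * levy_exponent gamma sigma2 Pi theta).

(* Meaningful for processes of bounded variation, for which x is
   Pi-integrable. *)
Definition drift (R : realType) (gamma : R)
    (Pi : {measure set (measurableTypeR R) -> \bar R}) : R :=
  gamma - Rintegral Pi `[-1, 1] (fun x : R => x).

(* Main.v *)
Require Import Defs.
From HB Require Import structures.
From mathcomp Require Import all_boot all_order all_algebra complex.
From mathcomp Require Import all_classical all_reals all_analysis.
From mathcomp Require Import measurable_realfun ring lra.

(** The jump measure is never decomposed along paths: everything is read off the
    characteristic exponent [Psi], with [psi u = - Re (Psi u)].

    Put [alpha = 1 / kappa]. If the conclusion fails, then for some [M] and [delta]
    the tube [|X_t - a t| <= M t ^ kappa] on [(0, delta)] is not negligible, so its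
    restrictions to finite sets of times have probability bounded below. By
    independence of the increments over a fine grid of the geometric blocks
    [[2 ^ (- alpha (n + 1)), 2 ^ (- alpha n)]], a concentration inequality for the
    symmetrized increments bounds [sum_n 2 ^ (- alpha n) int (1 - cos (2 ^ n x)) ^ 2 dPi],
    that is, [int |x| ^ alpha dPi] is finite. Then [|Psi u| = O(u ^ alpha + u)], and
    [O(u ^ alpha)] when [kappa > 1], because in that case [X] has bounded variation and
    drift zero. Hence [X_t / t ^ kappa] is tight as [t] tends to [0], which forces
    [a t = O(t ^ kappa)], and the tube is contained in the null event
    [limsup |X_t| / t ^ kappa < oo]. *)

Set Implicit Arguments.
Unset Strict Implicit.
Unset Printing Implicit Defensive.

Import Order.TTheory GRing.Theory Num.Theory.
Import numFieldNormedType.Exports.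
Local Open Scope classical_set_scope.
Local Open Scope ring_scope.

(** * Cosine inequalities *)

(** Finite sets of times are forced: [a] is arbitrary, so the tube over all times need not be
    measurable. Nor can [a] be estimated beforehand, but symmetrizing an increment cancels its
    deterministic part, which is why the concentration inequality involves only differences
    [Y w - Y w']. Near time [2 ^ (- alpha n)] the tube has width of order [2 ^ (- n)], so [2 ^ n] is
    the frequency that resolves it. The kernel has to be a trigonometric polynomial, to be read off
    the exponent, and nonpositive near 0. It is [(1 - cos z) ^ 2] minus a multiple of its dilate
    [(1 - cos (4 z)) ^ 2]. The square matters: [1 - cos] is only quadratic, and at [kappa = 1/2] the
    dilate could then not be absorbed in the sum over scales. The grid has to be fine because the
    concentration bound is sharp only to first order in the length of an increment: cutting each
    block into [N] pieces keeps the first-order total and divides the second-order one by [N]. Drift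
    zero is assumed only for paths of bounded variation, so for [kappa > 1] that property is derived
    first, from [E |X_t| = O(t)] and dyadic partitions. *)

Section trigonometric_inequalities.
Context {R : realType}.
Implicit Types x y z : R.

Let continuous_within (f : R -> R) (A : set R) :
  continuous f -> {within A, continuous f}.
Proof. by move=> cf; apply: continuous_subspaceT. Qed.

Lemma onem_cos_ge0 x : 0 <= 1 - cos x.
Proof. by rewrite subr_ge0 cos_le1. Qed.

Lemma onem_cos_le2 x : 1 - cos x <= 2.
Proof. by have := cos_geN1 x; lra. Qed.

Lemma norm_sin_le x : `|sin x| <= `|x|.
Proof.
wlog x0 : x / 0 <= x.
  move=> h; case: (leP 0 x) => [/h//|x0].
  by have := h (- x); rewrite sinN !normrN; apply; rewrite oppr_ge0 ltW.
have sin' y : y \in `]0, x[ -> is_derive y 1 sin (cos y).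
  by move=> _; exact: is_derive_sin.
have csin : {within `[0, x], continuous (@sin R)}.
  by apply: continuous_within; exact: continuous_sin.
have [c _] := MVT_segment x0 sin' csin.
rewrite sin0 !subr0 => ->; rewrite normrM ler_piMl//; exact: cos_max.
Qed.

Lemma onem_cosE x : 1 - cos x = 2 * sin (x / 2) ^+ 2.
Proof.
have -> : cos x = cos ((x / 2) *+ 2) by congr cos; rewrite mulr2n; field.
by rewrite cos_mulr2n sin2cos2 -mulr_natl; ring.
Qed.

Lemma onem_cos_le_sqr x : 1 - cos x <= x ^+ 2 / 2.
Proof.
rewrite onem_cosE -(real_normK (num_real (sin _))).
have h : `|sin (x / 2)| <= `|x / 2| := norm_sin_le _.
have : `|sin (x / 2)| ^+ 2 <= `|x / 2| ^+ 2 by rewrite lerXn2r ?nnegrE.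
by rewrite (real_normK (num_real (x / 2))); lra.
Qed.

Lemma onem_cos_le_norm x : 1 - cos x <= `|x|.
Proof.
have h1 := onem_cos_le2 x; have := onem_cos_le_sqr x.
rewrite -(real_normK (num_real x)) => h2.
have h3 := normr_ge0 x.
case: (leP `|x| 2) => h; nra.
Qed.

(** The mean value theorem gives [x * (1 - cos c)] with [0 < c < x], and [1 - cos c] is at most both
    [c] and [2]. Keeping both bounds allows a comparison with [|x| ^ a] for every [a] between 1 and
    2. *)
Lemma norm_sin_sub_le x : `|sin x - x| <= Num.min (x ^+ 2) (2 * `|x|).
Proof.
wlog x0 : x / 0 <= x.
  move=> h; case: (leP 0 x) => [/h//|x0].
  have := h (- x); rewrite (_ : sin (- x) - - x = - (sin x - x)).
    by rewrite sqrrN !normrN; apply; rewrite oppr_ge0 ltW.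
  by rewrite sinN opprB opprK addrC.
have f' y : y \in `]0, x[ -> is_derive y 1 (fun z => z - sin z) (1 - cos y).
  by move=> _; apply: is_deriveB.
have cf : {within `[0, x], continuous (fun z : R => z - sin z)}.
  by apply: continuous_within => y; apply: cvgB; [exact: cvg_id|exact: continuous_sin].
have [c] := MVT_segment x0 f' cf.
rewrite in_itv/= => /andP[c0 cx].
rewrite sin0 !subr0 => h; rewrite distrC h normrM.
rewrite (ger0_norm x0) (ger0_norm (onem_cos_ge0 _)) le_min; apply/andP; split.
  by rewrite expr2 ler_wpM2r// (le_trans (onem_cos_le_norm _))// ger0_norm.
by rewrite ler_wpM2r// onem_cos_le2.
Qed.

Lemma onem_cos1_gt0 : 0 < 1 - cos (1 : R).
Proof.
have pi2 := @pi_ge2 R.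
rewrite subr_gt0 -[ltRHS](@cos0 R) ltr_cos// in_itv/= ?lexx ?pi_ge0//.
by rewrite ler01/= (le_trans _ pi2)// ler1n.
Qed.

Lemma onem_cos1_le x : 1 <= `|x| <= 2 -> 1 - cos 1 <= 1 - cos x.
Proof.
move=> /andP[x1 x2]; have pi2 := @pi_ge2 R.
rewrite lerD2l lerN2 -(cos_norm x) le_eqVlt.
have [->|x1'] := eqVneq `|x| 1; first by rewrite eqxx.
by rewrite ltr_cos ?lt_neqAle ?(eq_sym 1) ?x1' ?x1 ?orbT// in_itv/=; apply/andP; split; lra.
Qed.

Lemma cos_double x : cos (2 * x) = 2 * cos x ^+ 2 - 1.
Proof. by rewrite mulr_natl cos_mulr2n -mulr_natl. Qed.

Lemma onem_cos_sqr x : (1 - cos x) ^+ 2 = 3 / 2 - 2 * cos x + cos (2 * x) / 2.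
Proof. by rewrite cos_double; field. Qed.

(** The ratio tends to 4 at the origin. The constant 3 only needs [cos x >= 1/2], since the
    difference of the sides is [(1 - cos x) * (2 cos x - 1)]. *)
Lemma onem_cos_double_ge x : `|x| <= 1 -> 3 * (1 - cos x) <= 1 - cos (2 * x).
Proof.
move=> x1; have := onem_cos_le_sqr x; rewrite cos_double.
have : x ^+ 2 <= 1 by rewrite -(real_normK (num_real x)) expr_le1.
have := onem_cos_ge0 x.
set c := cos x => h1 h2 h3.
rewrite -subr_ge0 [leRHS](_ : _ = (1 - c) * (2 * c - 1)); last by ring.
by apply: mulr_ge0 => //; lra.
Qed.

(** Two doublings give the factor 9 and squaring gives 81; [|x| <= 1/2] keeps [2 x] in the range of
    the doubling inequality. *)
Lemma onem_cos_sqr_le x : `|x| <= 2^-1 ->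
  81 * (1 - cos x) ^+ 2 <= (1 - cos (4 * x)) ^+ 2.
Proof.
move=> hx; have h0 := onem_cos_ge0 x.
have h1 := @onem_cos_double_ge x; have h2 := @onem_cos_double_ge (2 * x).
have : `|2 * x| <= 1 by rewrite normrM ger0_norm//; lra.
have {}/h1 : `|x| <= 1 by lra.
move=> h1 {}/h2; rewrite (_ : 2 * (2 * x) = 4 * x); last by ring.
move=> h2; nra.
Qed.

(** The left side is the concentration kernel, a trigonometric polynomial in [x]. Its sign near 0
    penalizes laws that concentrate on short intervals. *)
Lemma onem_cos_sqr_sub_le x :
  (1 - cos x) ^+ 2 - 81^-1 * (1 - cos (4 * x)) ^+ 2 <=
  if `|x| <= 2^-1 then 0 else 4.
Proof.
case: ifPn => [/onem_cos_sqr_le|_]; first lra.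
have h0 := onem_cos_ge0 x; have h1 := onem_cos_le2 x.
have := sqr_ge0 (1 - cos (4 * x)); nra.
Qed.

End trigonometric_inequalities.

(** * Sums of cosine terms over dyadic scales *)

Section dyadic_windows.
Context {R : realType}.
Implicit Types x y z : R.

(** Some scale puts [|z / 2 ^ k|] in [[1, 2]], where [1 - cos] is at least [1 - cos 1], and the
    other terms are nonnegative. The other lower bounds of this section select a scale in the same
    way. *)
Lemma window_onem_cos z n : 1 <= `|z| < 2 ^+ n ->
  1 - cos 1 <= \sum_(k < n) (1 - cos (z / 2 ^+ k)).
Proof.
elim: n z => [|n ih] z /andP[z1 zn]; first by move: zn; rewrite expr0; lra.
rewrite big_ord_recl/= expr0 divr1.
have s0 : 0 <= \sum_(i < n) (1 - cos (z / 2 ^+ bump 0 i)).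
  by apply: sumr_ge0 => i _; exact: onem_cos_ge0.
case: (leP `|z| 2) => z2.
  by rewrite -[leLHS]addr0 lerD// onem_cos1_le// z1.
rewrite -[leLHS]add0r lerD ?onem_cos_ge0//.
rewrite (eq_bigr (fun k : 'I_n => 1 - cos (z / 2 / 2 ^+ k))).
  apply: ih; rewrite normrM [`|2^-1|]ger0_norm ?invr_ge0//.
  rewrite ler_pdivlMr// mul1r ltW//= ltr_pdivrMr//.
  by rewrite (lt_le_trans zn)// exprSr.
by move=> i _; rewrite /bump/= exprS invfM mulrA.
Qed.

Lemma window_norm z n : 1 <= `|z| < 2 ^+ n ->
  `|z| * (1 - cos 1) <= 2 * \sum_(k < n) 2 ^+ k * (1 - cos (z / 2 ^+ k)).
Proof.
elim: n z => [|n ih] z /andP[z1 zn]; first by move: zn; rewrite expr0; lra.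
rewrite big_ord_recl/= expr0 divr1 mul1r [leRHS]mulrDr.
have s0 : 0 <= \sum_(i < n) 2 ^+ bump 0 i * (1 - cos (z / 2 ^+ bump 0 i)).
  by apply: sumr_ge0 => i _; rewrite mulr_ge0 ?exprn_ge0 ?onem_cos_ge0.
have c1 := @onem_cos1_gt0 R.
case: (leP `|z| 2) => z2.
  have := @onem_cos1_le R z; rewrite z1 z2 => /(_ isT) hz.
  rewrite -[leLHS]addr0 lerD//; last by rewrite mulr_ge0.
  by rewrite ler_pM// ltW.
rewrite -[leLHS]add0r lerD ?mulr_ge0 ?onem_cos_ge0//.
rewrite (eq_bigr (fun k : 'I_n => 2 * (2 ^+ k * (1 - cos (z / 2 / 2 ^+ k))))).
  have e : `|z| = 2 * `|z / 2|.
    by rewrite normrM [`|2^-1|]ger0_norm// mulrCA divff ?mulr1.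
  rewrite -mulr_sumr [in leLHS]e -mulrA ler_pM2l//.
  apply: ih; rewrite normrM [`|2^-1|]ger0_norm//.
  rewrite ler_pdivlMr// mul1r ltW//= ltr_pdivrMr//.
  by rewrite (lt_le_trans zn)// exprSr.
by move=> i _; rewrite /bump/= add1n exprS invfM !mulrA.
Qed.

Lemma window_min y n : 0 <= y ->
  \sum_(k < n) 2 ^+ k * Num.min 2 ((y / 2 ^+ k) ^+ 2 / 2) <= 4 * y.
Proof.
(* The quadratic bound below scale [1] makes the induction close above it. *)
have main_bound m (u : R) : 0 <= u ->
    \sum_(k < m) 2 ^+ k * Num.min 2 ((u / 2 ^+ k) ^+ 2 / 2) <= u ^+ 2 /\
    (1 <= u ->
     \sum_(k < m) 2 ^+ k * Num.min 2 ((u / 2 ^+ k) ^+ 2 / 2) <= 4 * u - 2).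
  elim: m u => [|m ih] u u0; first by rewrite !big_ord0; split => [|u1]; nra.
  rewrite big_ord_recl/= expr0 divr1 mul1r.
  rewrite (eq_bigr (fun k : 'I_m =>
      2 * (2 ^+ k * Num.min 2 ((u / 2 / 2 ^+ k) ^+ 2 / 2)))); last first.
    by move=> i _; rewrite /bump/= add1n exprS invfM !mulrA.
  rewrite -mulr_sumr; have [|h1 h2] := ih (u / 2); first by rewrite divr_ge0.
  set s := \sum_(_ < _) _ in h1 h2 *.
  have m1 : Num.min 2 (u ^+ 2 / 2) <= 2 by rewrite ge_min lexx.
  have m2 : Num.min 2 (u ^+ 2 / 2) <= u ^+ 2 / 2 by rewrite ge_min lexx orbT.
  move: (Num.min _ _) m1 m2 => t m1 m2.
  have h3 : t + 2 * s <= u ^+ 2 by move: h1; lra.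
  split => // u1; case: (leP 2 u) => u2; last by nra.
  have : s <= 4 * (u / 2) - 2 by apply: h2; lra.
  lra.
move=> y0; have [h1 h2] := main_bound n y y0.
case: (leP 1 y) => y1; first by have := h2 y1; lra.
nra.
Qed.

(** At the scale where [2 ^ k |x|] lies in [[1, 2]], the weight [2 ^ (- a k)] is comparable to
    [|x| ^ a], with a loss of at most [2 ^ a <= 4]. *)
Lemma window_powR (a : R) x n : 0 < a <= 2 -> `|x| <= 2 -> 2 < 2 ^+ n * `|x| ->
  `|x| `^ a * (1 - cos 1) ^+ 2 <=
  4 * \sum_(k < n) (2 `^ (- a)) ^+ k * (1 - cos (2 ^+ k * x)) ^+ 2.
Proof.
move=> /andP[a0 a2]; elim: n x => [|n ih] x x2 xn.
  by move: xn; rewrite expr0 mul1r; lra.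
rewrite big_ord_recl/= !expr0 !mul1r mulrDr.
have s0 : 0 <= \sum_(i < n) (2 `^ (- a)) ^+ bump 0 i * (1 - cos (2 ^+ bump 0 i * x)) ^+ 2.
  by apply: sumr_ge0 => i _; rewrite mulr_ge0 ?exprn_ge0 ?powR_ge0 ?sqr_ge0.
have c1 := @onem_cos1_gt0 R.
case: (leP 1 `|x|) => x1.
  have := @onem_cos1_le R x; rewrite x1 x2 => /(_ isT) hx.
  rewrite -[leLHS]addr0 lerD//; last by rewrite mulr_ge0.
  rewrite ler_pM ?powR_ge0 ?sqr_ge0//; last by rewrite lerXn2r ?nnegrE// ltW// (lt_le_trans c1).
  apply: (@le_trans _ _ (2 `^ a)).
    by rewrite ge0_ler_powR ?nnegrE// ltW.
  have -> : (4 : R) = 2 `^ 2 by rewrite powR_mulrn// expr2 -natrM.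
  by apply: ler_powR => //; rewrite ler1n.
rewrite -[leLHS]add0r lerD ?mulr_ge0 ?sqr_ge0//.
rewrite (eq_bigr (fun k : 'I_n => 2 `^ (- a) *
   ((2 `^ (- a)) ^+ k * (1 - cos (2 ^+ k * (2 * x))) ^+ 2))); last first.
  by move=> i _; rewrite /bump/= add1n !exprS -!mulrA (mulrCA 2).
have e : `|2 * x| = 2 * `|x| by rewrite normrM ger0_norm.
have x2' : `|2 * x| <= 2 by rewrite e; lra.
have xn' : 2 < 2 ^+ n * `|2 * x| by rewrite e mulrA -exprSr.
have := ih _ x2' xn'; rewrite e.
move=> h; rewrite -mulr_sumr [leRHS]mulrCA [X in _ <= X * _]powRN.
by rewrite ler_pdivlMl ?powR_gt0// mulrA -powRM.
Qed.

End dyadic_windows.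

(** * Interpolation of truncated powers, and elementary limit arguments *)

Section power_inequalities.
Context {R : realType}.
Implicit Types x y a : R.

Lemma min_sqr_le_powR a x : 0 < a <= 2 -> 0 <= x ->
  Num.min 2 (x ^+ 2 / 2) <= 2 * x `^ a.
Proof.
move=> /andP[a0 a2] x0; have p0 := powR_ge0 x a.
case: (leP x 1) => x1; last first.
  rewrite ge_min; apply/orP; left; rewrite ler_peMr//.
  by rewrite -(powRr0 x) ler_powR// ltW.
rewrite ge_min; apply/orP; right.
move: x0; rewrite le_eqVlt => /predU1P[<-|x0]; first by rewrite expr0n/= mul0r mulr_ge0 ?powR_ge0.
have : x ^+ 2 <= x `^ a by rewrite -(powR_mulrn 2 (ltW x0)) ger_powR// x0.
lra.
Qed.

Lemma min_sqr_lin_le_powR a x : 1 <= a <= 2 -> 0 <= x ->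
  Num.min (x ^+ 2) (2 * x) <= 2 * x `^ a.
Proof.
move=> /andP[a0 a2] x0; have p0 := powR_ge0 x a.
case: (leP x 1) => x1; last first.
  rewrite ge_min; apply/orP; right; rewrite ler_pM2l//.
  by rewrite le1r_powR// ltW.
rewrite ge_min; apply/orP; left.
move: x0; rewrite le_eqVlt => /predU1P[<-|x0]; first by rewrite expr0n/= mulr_ge0 ?powR_ge0.
have : x ^+ 2 <= x `^ a by rewrite -(powR_mulrn 2 (ltW x0)) ger_powR// x0.
lra.
Qed.

Lemma min_lin_le_powR a x : 0 < a <= 1 -> 0 <= x -> Num.min 1 x <= x `^ a.
Proof.
move=> /andP[a0 a1] x0; have p0 := powR_ge0 x a.
case: (leP x 1) => x1; last first.
  by rewrite -(powRr0 x); apply: ler_powR; apply: ltW.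
move: x0; rewrite le_eqVlt => /predU1P[<-|x0]; first exact: powR_ge0.
by rewrite ger1_powR// x0.
Qed.

Lemma norm_expRN_sub x : 0 <= x -> `|expR (- x) - 1 + x| <= x ^+ 2.
Proof.
move=> x0; have h1 := expR_ge1Dx (- x); have h2 := expR_ge1Dx x.
rewrite ger0_norm; last by lra.
rewrite expRN; have p := expR_gt0 x.
have : (expR x)^-1 <= (1 + x)^-1 by rewrite lef_pV2 ?posrE//; lra.
have : (1 + x)^-1 <= 1 - x + x ^+ 2.
  rewrite -[leLHS]mul1r ler_pdivrMr; last lra.
  have : 0 <= x ^+ 3 by exact: exprn_ge0.
  rewrite (_ : (1 - x + x ^+ 2) * (1 + x) = 1 + x ^+ 3); last ring.
  lra.
lra.
Qed.

Lemma le_of_geometric_error (x A B s : R) : `|s| < 1 ->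
  (forall k, x <= A + B * s ^+ k) -> x <= A.
Proof.
move=> s1 h; have : (fun k => A + B * s ^+ k) @ \oo --> A + B * 0.
  by apply: cvgD; [exact: cvg_cst|apply: cvgMr; exact: cvg_expr].
by rewrite mulr0 addr0 => /cvgr_to_ge; apply; exact: nearW.
Qed.

(* Iterating the hypothesis [k] times leaves the error [rho ^+ k * S (N + 2 k)],
   which the a priori growth bound makes vanish. *)
Lemma bounded_by_self_improvement (S : nat -> R) (K rho C r : R) :
  0 <= K -> 0 <= rho < 1 -> 0 <= r -> rho * r ^+ 2 < 1 ->
  (forall N, S N <= C * r ^+ N) -> (forall N, S N <= K + rho * S N.+2) ->
  forall N, S N <= K / (1 - rho).
Proof.
move=> K0 /andP[rho0 rho1] r0 rr SC SK N.
have it k : S N <= K / (1 - rho) * (1 - rho ^+ k) + rho ^+ k * S (N + 2 * k)%N.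
  elim: k => [|k ih]; first by rewrite muln0 addn0 expr0 subrr mulr0 add0r mul1r.
  apply: (le_trans ih); have := SK (N + 2 * k)%N.
  rewrite -(addn2 (_ + _)) -addnA (_ : 2 * k + 2 = 2 * k.+1)%N; last by rewrite mulnS addnC.
  have rk : 0 <= rho ^+ k by exact: exprn_ge0.
  move=> h; have {}h := ler_wpM2l rk h.
  have -> : K / (1 - rho) * (1 - rho ^+ k.+1) = K / (1 - rho) * (1 - rho ^+ k) + rho ^+ k * K.
    by rewrite exprS; field; lra.
  rewrite exprS; move: h; lra.
apply: (@le_of_geometric_error _ _ (C * r ^+ N) (rho * r ^+ 2)).
  by rewrite ger0_norm// mulr_ge0// sqr_ge0.
move=> k; apply: (le_trans (it k)); apply: lerD.
  rewrite ler_piMr ?divr_ge0//; last 1 first.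
    by rewrite gerBl exprn_ge0.
  lra.
rewrite exprMn -exprM mulrCA ler_wpM2l ?exprn_ge0// (le_trans (SC _))//.
by rewrite exprD mulrA.
Qed.

End power_inequalities.

(** * Integrals and the characteristic exponent *)

Section integral_lemmas.
Context d (T : measurableType d) (R : realType).
Variable mu : {measure set T -> \bar R}.
Implicit Types (D : set T) (f g : T -> R).

(** Fatou's lemma, with a threshold in [n] that may depend on [x]. It passes from cosine sums over
    finitely many scales to [|x| ^ alpha], [|X_t|] or an indicator, with no integrability known in
    advance. *)
Lemma ge0_integral_le_of_eventually_le D f (h : nat -> T -> R) (B : R) :
  measurable D -> measurable_fun D f -> (forall n, measurable_fun D (h n)) ->
  (forall x, D x -> 0 <= f x) -> (forall n x, D x -> 0 <= h n x) ->
  (forall x, D x -> \forall n \near \oo, f x <= h n x) ->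
  (forall n, (\int[mu]_(x in D) (h n x)%:E <= B%:E)%E) ->
  (\int[mu]_(x in D) (f x)%:E <= B%:E)%E.
Proof.
move=> mD mf mh f0 h0 fh hB.
have mh' n : measurable_fun D (fun x => (h n x)%:E) by exact/measurable_EFinP.
have h0' n x : D x -> (0 <= (h n x)%:E)%E by move=> Dx; rewrite lee_fin h0.
apply: (@le_trans _ _ (\int[mu]_(x in D) limn_einf (fun n => (h n x)%:E))%E).
  apply: ge0_le_integral => //.
  - exact/measurable_EFinP.
  - apply: measurableT_comp => //.
    apply: (@measurable_fun_limn_esup _ _ _ D (fun n x => (- (h n x)%:E)%E)) => n.
    by apply: measurableT_comp => //; exact: mh'.
  - move=> x Dx; rewrite limn_einf_lim; apply: lime_ge; first exact: is_cvg_einfs.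
    have [N _ hN] := fh x Dx; exists N => // n /= Nn.
    apply: le_ereal_inf_tmp => _ [m /= nm <-]; rewrite lee_fin.
    by apply: hN => /=; exact: leq_trans nm.
apply: (le_trans (fatou mu mD mh' h0')).
rewrite limn_einf_lim; apply: lime_le; first exact: is_cvg_einfs.
apply: nearW => n; apply: ereal_inf_le; exists (\int[mu]_(x in D) (h n x)%:E)%E => //.
by exists n => //=.
Qed.

Lemma integrable_of_norm_le D f g : measurable D -> measurable_fun D f ->
  (forall x, D x -> `|f x| <= g x) -> mu.-integrable D (EFin \o g) ->
  mu.-integrable D (EFin \o f).
Proof.
move=> mD mf fg; apply: le_integrable => //; first exact/measurable_EFinP.
by move=> x Dx /=; rewrite lee_fin (le_trans (fg x Dx))// ler_norm.
Qed.

Lemma Rintegral_sum D n (F : 'I_n -> T -> R) : measurable D ->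
  (forall i, mu.-integrable D (EFin \o F i)) ->
  mu.-integrable D (EFin \o (fun x => \sum_(i < n) F i x)) /\
  \int[mu]_(x in D) (\sum_(i < n) F i x) = \sum_(i < n) \int[mu]_(x in D) F i x.
Proof.
move=> mD; elim: n F => [|n ih] F iF.
  split.
    rewrite (_ : _ \o _ = cst 0%E); first exact: integrable0.
    by apply/funext => x /=; rewrite big_ord0.
  rewrite big_ord0; under eq_Rintegral do rewrite big_ord0.
  by rewrite /Rintegral integral0.
have [i1 i2] := ih (fun i => F (lift ord0 i)) (fun i => iF _).
split.
  rewrite (_ : _ \o _ = ((EFin \o F ord0) \+ (EFin \o (fun x => \sum_(i < n) F (lift ord0 i) x)%R))%E).
    exact: integrableD.
  by apply/funext => x; rewrite /= big_ord_recl.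
rewrite big_ord_recl -i2 -RintegralD//.
by apply: eq_Rintegral => x _; rewrite big_ord_recl.
Qed.

Lemma EFin_Rintegral D f : measurable D -> mu.-integrable D (EFin \o f) ->
  ((\int[mu]_(x in D) f x)%:E = \int[mu]_(x in D) (f x)%:E)%E.
Proof. by move=> mD i; rewrite fineK//; exact: integrable_fin_num. Qed.

Lemma le_Rintegral_of_integral_le D f (B : R) : measurable D ->
  measurable_fun D f -> (forall x, D x -> 0 <= f x) ->
  (\int[mu]_(x in D) (f x)%:E <= B%:E)%E ->
  mu.-integrable D (EFin \o f) /\ \int[mu]_(x in D) f x <= B.
Proof.
move=> mD mf f0 fB.
have i : mu.-integrable D (EFin \o f).
  apply/integrableP; split; first exact/measurable_EFinP.
  apply: (@le_lt_trans _ _ B%:E); last exact: ltry.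
  apply: le_trans fB; rewrite le_eqVlt; apply/orP; left; apply/eqP.
  by apply: eq_integral => x /set_mem Dx /=; rewrite ger0_norm// f0.
by split=> //; rewrite -lee_fin EFin_Rintegral.
Qed.

End integral_lemmas.

Lemma measurable_cos_mul (R : realType) (u : R) :
  measurable_fun setT (fun x : R => cos (u * x)).
Proof.
apply: continuous_measurable_fun => x; apply: continuous_comp.
  exact: mulrl_continuous.
exact: continuous_cos.
Qed.

Lemma measurable_sin_mul (R : realType) (u : R) :
  measurable_fun setT (fun x : R => sin (u * x)).
Proof.
apply: continuous_measurable_fun => x; apply: continuous_comp.
  exact: mulrl_continuous.
exact: continuous_sin.
Qed.

Section probability_lemmas.
Context d (T : measurableType d) (R : realType) (P : probability T R).

Lemma integrable_of_bounded (f : T -> R) (M : R) : measurable_fun setT f ->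
  (forall x, `|f x| <= M) -> P.-integrable setT (EFin \o f).
Proof.
move=> mf fM; apply: (@integrable_of_norm_le _ _ _ _ _ _ (cst M)) => //.
exact: finite_measure_integrable_cst.
Qed.

Lemma integrable_cos (Y : {RV P >-> R}) (u : R) :
  P.-integrable setT (EFin \o (fun w => cos (u * Y w))).
Proof.
apply: (@integrable_of_bounded _ 1) => [|w]; last exact: cos_max.
exact: (measurableT_comp (@measurable_cos_mul R u)).
Qed.

Lemma integrable_sin (Y : {RV P >-> R}) (u : R) :
  P.-integrable setT (EFin \o (fun w => sin (u * Y w))).
Proof.
apply: (@integrable_of_bounded _ 1) => [|w]; last exact: sin_max.
exact: (measurableT_comp (@measurable_sin_mul R u)).
Qed.

Lemma Rintegral_probability_cst (r : R) : \int[P]_w r = r.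
Proof. by rewrite Rintegral_cst//= (@probability_setT _ _ _ P) mulr1. Qed.

Lemma Rintegral_onem_cos (Y : {RV P >-> R}) (u : R) :
  \int[P]_w (1 - cos (u * Y w)) = 1 - \int[P]_w cos (u * Y w).
Proof.
rewrite RintegralB//; last exact: integrable_cos.
  by rewrite Rintegral_probability_cst.
exact: finite_measure_integrable_cst.
Qed.

Lemma integrable_onem_cos (Y : {RV P >-> R}) (u : R) :
  P.-integrable setT (EFin \o (fun w => 1 - cos (u * Y w))).
Proof.
apply: (@integrable_of_bounded _ 2) => [|w].
  apply: measurable_funB => //.
  exact: (measurableT_comp (@measurable_cos_mul R u)).
by rewrite ger0_norm ?onem_cos_ge0// onem_cos_le2.
Qed.

End probability_lemmas.

Lemma cexp_imag (R : realType) (y : R) :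
  cexp (complex.Complex 0 y) = complex.Complex (cos y) (sin y).
Proof. by rewrite /cexp /= expR0; simpc; congr complex.Complex; ring. Qed.

Section levy_exponent.
Context {R : realType} (Pi : {measure set (measurableTypeR R) -> \bar R}).
Hypothesis hPi : unit_levy_measure Pi.
Notation D := (`[-1, 1]%classic : set (measurableTypeR R)).

(** Minus the real part of [Psi], so that the characteristic function of [X_t] has modulus
    [exp (- t * levy_re u)]; [levy_im] is the imaginary part. *)
Definition levy_re (u : R) : R := \int[Pi]_(x in D) (1 - cos (u * x)).

Definition levy_im (gamma u : R) : R :=
  gamma * u + \int[Pi]_(x in D) (sin (u * x) - u * x).

Lemma measurable_levy_domain : measurable D.
Proof. exact: measurable_itv. Qed.

Lemma integrable_sqr : Pi.-integrable D (EFin \o (fun x : R => x ^+ 2)).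
Proof.
apply: (@integrableS _ _ _ _ setT) => //; apply/integrableP; split.
  by apply/measurable_EFinP; apply: (@measurable_funX _ (measurableTypeR R)).
have [_] := hPi; apply: le_lt_trans; rewrite le_eqVlt; apply/orP; left; apply/eqP.
by apply: eq_integral => x _ /=; rewrite ger0_norm ?sqr_ge0.
Qed.

Lemma integrable_levy_re u :
  Pi.-integrable D (EFin \o (fun x : R => 1 - cos (u * x))).
Proof.
apply: (@integrable_of_norm_le _ _ _ Pi D _ (fun x : measurableTypeR R => u ^+ 2 * x ^+ 2)).
- exact: measurable_levy_domain.
- apply: measurable_funTS; apply: measurable_funB => //.
  exact: measurable_cos_mul.
- move=> x _; rewrite ger0_norm ?onem_cos_ge0// (le_trans (onem_cos_le_sqr _))//.
  by rewrite exprMn; have := sqr_ge0 (u * x); rewrite exprMn; lra.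
- exact: (integrableZl measurable_levy_domain (u ^+ 2) integrable_sqr).
Qed.

Lemma integrable_levy_im u :
  Pi.-integrable D (EFin \o (fun x : R => sin (u * x) - u * x)).
Proof.
apply: (@integrable_of_norm_le _ _ _ Pi D _ (fun x : measurableTypeR R => u ^+ 2 * x ^+ 2)).
- exact: measurable_levy_domain.
- apply: measurable_funTS; apply: measurable_funB => //.
  exact: measurable_sin_mul.
- move=> x _; rewrite (le_trans (norm_sin_sub_le _))//.
  by rewrite ge_min exprMn lexx.
- exact: (integrableZl measurable_levy_domain (u ^+ 2) integrable_sqr).
Qed.

Lemma levy_re_ge0 u : 0 <= levy_re u.
Proof. by apply: Rintegral_ge0 => x _; exact: onem_cos_ge0. Qed.

Context d (T : measurableType d) (P : probability T R) (X : R -> {RV P >-> R}).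
Variable gamma : R.
Hypothesis hX : has_triplet X gamma 0 Pi.

Lemma char_fun_levy t u : 0 <= t ->
  \int[P]_w cos (u * X t w) = expR (- (t * levy_re u)) * cos (t * levy_im gamma u) /\
  \int[P]_w sin (u * X t w) = expR (- (t * levy_re u)) * sin (t * levy_im gamma u).
Proof.
move=> t0; have := hX u t0.
have -> : levy_exponent gamma 0 Pi u = complex.Complex (- levy_re u) (levy_im gamma u).
  rewrite /levy_exponent.
  have -> : Cintegral Pi D (fun x => cexp (complex.Complex 0 (u * x)) - 1 -
      complex.Complex 0 (u * x)) = complex.Complex
      (\int[Pi]_(x in D) (-1 * (1 - cos (u * x))))
      (\int[Pi]_(x in D) (sin (u * x) - u * x)).
    by rewrite /Cintegral; congr complex.Complex; apply: eq_Rintegral => x _;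
      rewrite cexp_imag; simpc; rewrite //=; ring.
  rewrite RintegralZl//; last exact: integrable_levy_re.
  rewrite /levy_im /levy_re; simpc.
  by congr (complex.Complex _ _); ring.
have -> : char_fun P (X t) u = complex.Complex
    (\int[P]_w cos (u * X t w)) (\int[P]_w sin (u * X t w)).
  by rewrite /char_fun /Cintegral; congr complex.Complex; apply: eq_Rintegral => x _;
    rewrite cexp_imag.
rewrite /cexp /=.
move=> [-> ->]; rewrite !mul0r !subr0 !addr0 !mulrN; split; ring.
Qed.

End levy_exponent.

(** * Concentration of symmetrized increments *)

Section concentration.
Context d (T : measurableType d) (R : realType) (P : probability T R).

Lemma Rintegral_trig_sum (Y : {RV P >-> R}) n (s p r : 'I_n -> R) :
  P.-integrable setT (EFin \o
    (fun w => \sum_(i < n) (p i * cos (s i * Y w) + r i * sin (s i * Y w)))) /\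
  \int[P]_w (\sum_(i < n) (p i * cos (s i * Y w) + r i * sin (s i * Y w))) =
  \sum_(i < n) (p i * \int[P]_w cos (s i * Y w) + r i * \int[P]_w sin (s i * Y w)).
Proof.
have iC i : P.-integrable setT (EFin \o (fun w => p i * cos (s i * Y w))).
  exact: (integrableZl measurableT (p i) (integrable_cos Y (s i))).
have iS i : P.-integrable setT (EFin \o (fun w => r i * sin (s i * Y w))).
  exact: (integrableZl measurableT (r i) (integrable_sin Y (s i))).
have [|i1 ->] := @Rintegral_sum _ _ _ P setT n
  (fun i w => p i * cos (s i * Y w) + r i * sin (s i * Y w)) measurableT.
  by move=> i; exact: (integrableD measurableT (iC i) (iS i)).
split => //; apply: eq_bigr => i _; rewrite RintegralD//.
by rewrite !RintegralZl//; [exact: integrable_sin|exact: integrable_cos].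
Qed.

Lemma Rintegral_cst_sub_indic (A : set T) (B k : R) : measurable A ->
  P.-integrable setT (EFin \o (fun w => B - k * \1_A w)) /\
  \int[P]_w (B - k * \1_A w) = B - k * fine (P A).
Proof.
move=> mA.
have iA : P.-integrable setT (EFin \o (\1_A : T -> R)).
  apply: (@integrable_of_bounded _ _ _ _ _ 1); first exact: measurable_indic.
  by move=> w; rewrite indicE normr_nat lern1 leq_b1.
have ikA := integrableZl measurableT k iA.
have iB : P.-integrable setT (EFin \o cst B) by exact: finite_measure_integrable_cst.
split; first exact: (integrableB measurableT iB ikA).
rewrite RintegralB// RintegralZl// Rintegral_probability_cst.
by rewrite [in LHS]/Rintegral integral_indic// setIT.
Qed.

(* Symmetrization without an independent copy: integrating the hypothesis in [w']
   and then in [w] turns [cos (s * (Y w - Y w'))] into the squared modulus of the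
   characteristic function. *)
Lemma trig_sum_concentration (Y : {RV P >-> R}) n (a s : 'I_n -> R) (A : set T)
    (B k : R) : measurable A ->
  (forall w w', \sum_(i < n) a i * cos (s i * (Y w - Y w')) <=
                B - k * (\1_A w * \1_A w')) ->
  \sum_(i < n) a i * ((\int[P]_w cos (s i * Y w)) ^+ 2 +
                      (\int[P]_w sin (s i * Y w)) ^+ 2) <=
  B - k * fine (P A) ^+ 2.
Proof.
move=> mA h.
pose C i := \int[P]_w cos (s i * Y w); pose S i := \int[P]_w sin (s i * Y w).
have inner w : \sum_(i < n) (a i * C i * cos (s i * Y w) + a i * S i * sin (s i * Y w)) <=
    B - k * fine (P A) * \1_A w.
  have [i1 e1] := Rintegral_trig_sum Y s (fun i => a i * cos (s i * Y w))
    (fun i => a i * sin (s i * Y w)).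
  have [i2 e2] := Rintegral_cst_sub_indic B (k * \1_A w) mA.
  have := le_Rintegral measurableT i1 i2; rewrite e1 e2 => le12.
  rewrite [leRHS](_ : _ = B - k * \1_A w * fine (P A)); last by ring.
  apply: le_trans (le12 _); last first.
    move=> w' _; rewrite -mulrA; apply: le_trans (h w w').
    rewrite le_eqVlt; apply/orP; left; apply/eqP; apply: eq_bigr => i _.
    by rewrite mulrBr cosB; ring.
  by rewrite le_eqVlt; apply/orP; left; apply/eqP; apply: eq_bigr => i _; rewrite /C /S; ring.
have [i1 e1] := Rintegral_trig_sum Y s (fun i => a i * C i) (fun i => a i * S i).
have [i2 e2] := Rintegral_cst_sub_indic B (k * fine (P A)) mA.
have := le_Rintegral measurableT i1 i2; rewrite e1 e2 => /(_ (fun w _ => inner w)).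
rewrite expr2 mulrA; apply: le_trans.
by rewrite le_eqVlt; apply/orP; left; apply/eqP; apply: eq_bigr => i _; rewrite /C /S; ring.
Qed.

End concentration.

Section levy_concentration.
Context {R : realType} (Pi : {measure set (measurableTypeR R) -> \bar R}).
Hypothesis hPi : unit_levy_measure Pi.
Notation D := (`[-1, 1]%classic : set (measurableTypeR R)).

Definition levy_sqr (u : R) : R := \int[Pi]_(x in D) (1 - cos (u * x)) ^+ 2.

(** Since [(1 - cos z) ^ 2 = 2 (1 - cos z) - (1 - cos (2 z)) / 2], this quartic functional of [Pi]
    can be read off the exponent at [u] and [2 u]. *)
Lemma levy_sqrE u : levy_sqr u = 2 * levy_re Pi u - levy_re Pi (2 * u) / 2.
Proof.
have mD := @measurable_levy_domain R.
have i1 := integrableZl mD 2 (integrable_levy_re hPi u).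
have i2 := integrableZl mD (2^-1) (integrable_levy_re hPi (2 * u)).
rewrite /levy_re [_ / 2]mulrC -!RintegralZl//; try exact: integrable_levy_re.
rewrite -RintegralB//; apply: eq_Rintegral => x _.
by rewrite onem_cos_sqr mulrA; field.
Qed.

Lemma levy_sqr_ge0 u : 0 <= levy_sqr u.
Proof. by apply: Rintegral_ge0 => x _; exact: sqr_ge0. Qed.

Lemma integrable_levy_sqr u :
  Pi.-integrable D (EFin \o (fun x : R => (1 - cos (u * x)) ^+ 2)).
Proof.
apply: (@integrable_of_norm_le _ _ _ Pi D _
  (fun x : measurableTypeR R => 2 * (1 - cos (u * x)))).
- exact: measurable_levy_domain.
- apply: measurable_funTS; apply: (@measurable_funX _ (measurableTypeR R)).
  by apply: measurable_funB => //; exact: measurable_cos_mul.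
- move=> x _; rewrite ger0_norm ?sqr_ge0// expr2.
  by rewrite ler_wpM2r ?onem_cos_ge0 ?onem_cos_le2.
- exact: (integrableZl (@measurable_levy_domain R) 2 (integrable_levy_re hPi u)).
Qed.

Context d (T : measurableType d) (P : probability T R) (X : R -> {RV P >-> R}).
Variable gamma : R.
Hypothesis hX : has_triplet X gamma 0 Pi.

Lemma char_fun_modulus t u : 0 <= t ->
  (\int[P]_w cos (u * X t w)) ^+ 2 + (\int[P]_w sin (u * X t w)) ^+ 2 =
  expR (- (2 * t * levy_re Pi u)).
Proof.
move=> t0; have [-> ->] := char_fun_levy hPi hX u t0.
rewrite !exprMn -mulrDr cos2Dsin2 mulr1 expr2 -expRD; congr expR; ring.
Qed.

Definition levy_sum4 u :=
  levy_re Pi u + levy_re Pi (2 * u) + levy_re Pi (4 * u) + levy_re Pi (8 * u).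

(** If [X_t] and a copy both lie within [r] of [c], then [u] times their difference is at most
    [2 u r <= 1/2], where the kernel is nonpositive. Its symmetrized mean is thus at most
    [4 - 4 P(A) ^ 2]; to first order in [t] that mean is [2 t (levy_sqr u - levy_sqr (4 u) / 81)].
    Dividing by 4 yields the bound, for every center [c]. *)
Lemma levy_concentration (t u c r : R) : 0 <= t -> 0 <= u -> 4 * (u * r) <= 1 ->
  fine (P [set w | `|X t w - c| <= r]) ^+ 2 <=
  expR (- (t / 2 * (levy_sqr u - levy_sqr (4 * u) / 81)) + 3 * (t * levy_sum4 u) ^+ 2).
Proof.
move=> t0 u0 ur.
set A := [set w | _].
have mA : measurable A.
  rewrite (_ : A = X t @^-1` `[c - r, c + r]); first exact: measurable_funPTI.
  by apply/seteqP; split => w; rewrite /A /= in_itv/= ler_distl.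
(* Fourier coefficients of the kernel at the frequencies 0, 1, 2, 4, 8. They sum to 0, so the
   expansion in [t] starts at first order. *)
pose a (i : 'I_5) : R := nth 0 [:: 40 / 27; -2; 1 / 2; 2 / 81; - (1 / 162)] i.
pose s (i : 'I_5) : R := u * nth 0 [:: 0; 1; 2; 4; 8] i.
have h w w' : \sum_(i < 5) a i * cos (s i * (X t w - X t w')) <=
    4 - 4 * (\1_A w * \1_A w').
  set z := u * (X t w - X t w').
  have -> : \sum_(i < 5) a i * cos (s i * (X t w - X t w')) =
      (1 - cos z) ^+ 2 - 81^-1 * (1 - cos (4 * z)) ^+ 2.
    rewrite !big_ord_recl big_ord0 /a /s /= mulr0 mul0r cos0 !mulr1 -/z.
    rewrite !onem_cos_sqr.
    rewrite (_ : u * 2 * _ = 2 * z); last by rewrite /z; ring.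
    rewrite (_ : u * 4 * _ = 4 * z); last by rewrite /z; ring.
    rewrite (_ : u * 8 * _ = 2 * (4 * z)); last by rewrite /z; ring.
    by field.
  apply: (le_trans (onem_cos_sqr_sub_le z)).
  rewrite !indicE; case: ifPn => [_|/negP hz].
    by case: (w \in A); case: (w' \in A); rewrite ?mulr0 ?mul0r ?mulr1 ?subr0 ?subrr.
  have [/set_mem wA|_] := boolP (w \in A); last by rewrite mul0r mulr0 subr0.
  have [/set_mem w'A|_] := boolP (w' \in A); last by rewrite mulr0 mulr0 subr0.
  exfalso; apply: hz; rewrite /z normrM (ger0_norm u0).
  have : `|X t w - X t w'| <= 2 * r.
    rewrite (_ : X t w - X t w' = (X t w - c) - (X t w' - c)); last by ring.
    rewrite (le_trans (ler_normB _ _))//; move: wA w'A; rewrite /A/=; lra.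
  by move=> /(ler_wpM2l u0); lra.
have := trig_sum_concentration mA h.
under eq_bigr do rewrite char_fun_modulus//.
rewrite !big_ord_recl big_ord0 /a /s /= mulr0.
have re0 : levy_re Pi 0 = 0.
  rewrite /levy_re (@eq_Rintegral _ _ _ Pi D (cst 0)); first by rewrite Rintegral_cst// mul0r.
  by move=> x _; rewrite mul0r cos0 subrr.
rewrite re0 mulr0 oppr0 expR0 !mulr1 ![u * _]mulrC.
have e v : 0 <= v -> `|expR (- (2 * t * v)) - 1 + 2 * t * v| <= (2 * t * v) ^+ 2.
  by move=> v0; apply: norm_expRN_sub; rewrite !mulr_ge0.
have := levy_re_ge0 Pi u; have := levy_re_ge0 Pi (2 * u).
have := levy_re_ge0 Pi (4 * u); have := levy_re_ge0 Pi (8 * u).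
rewrite !levy_sqrE /levy_sum4.
rewrite (_ : 2 * (4 * u) = 8 * u); last by ring.
move: (levy_re Pi u) (levy_re Pi (2 * u)) (levy_re Pi (4 * u)) (levy_re Pi (8 * u)).
move=> v1 v2 v3 v4 p4 p3 p2 p1.
have := e _ p1; have := e _ p2; have := e _ p3; have := e _ p4.
rewrite !ler_norml => /andP[a4 b4] /andP[a3 b3] /andP[a2 b2] /andP[a1 b1] hq.
(* Replacing [1 + v] by [exp v] makes the bounds of successive increments multiply into the
   exponential of a sum. *)
apply: (@le_trans _ _ (1 + (- (t / 2 * (2 * v1 - v2 / 2 - (2 * v3 - v4 / 2) / 81)) +
   3 * (t * (v1 + v2 + v3 + v4)) ^+ 2))); last exact: expR_ge1Dx.
have q1 : (t * v1) ^+ 2 + (t * v2) ^+ 2 + (t * v3) ^+ 2 + (t * v4) ^+ 2 <=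
    (t * (v1 + v2 + v3 + v4)) ^+ 2.
  rewrite -subr_ge0 [leRHS](_ : _ = t ^+ 2 * (2 * (v1 * v2 + v1 * v3 + v1 * v4 +
    v2 * v3 + v2 * v4 + v3 * v4))); last by ring.
  by rewrite mulr_ge0 ?sqr_ge0// mulr_ge0// !addr_ge0// mulr_ge0.
have := sqr_ge0 (t * v1); have := sqr_ge0 (t * v2).
have := sqr_ge0 (t * v3); have := sqr_ge0 (t * v4).
move: b1 a2 a3 b4 hq q1 => *; lra.
Qed.

End levy_concentration.

(** * Finiteness of the moment of order 1 / kappa *)

Section time_grid.
Context {R : realType} (H : nat -> R) (N : nat).
Hypothesis N0 : (0 < N)%N.

(** Linear interpolation of [H] with [N] equal steps per block: [j %/ N] is the block and [j %% N]
    the position in it. *)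
Definition refine_grid (j : nat) : R :=
  H (j %/ N) + (H (j %/ N).+1 - H (j %/ N)) * (j %% N)%:R / N%:R.

Let NR0 : N%:R != 0 :> R. Proof. by rewrite pnatr_eq0 -lt0n. Qed.

Lemma refine_grid0 : refine_grid 0 = H 0.
Proof. by rewrite /refine_grid div0n mod0n mulr0 mul0r addr0. Qed.

Lemma refine_gridS j : refine_grid j.+1 - refine_grid j =
  (H (j %/ N).+1 - H (j %/ N)) / N%:R.
Proof.
rewrite /refine_grid modnS divnS//; case: ifPn => dj.
  rewrite add1n mulr0 mul0r addr0.
  have e : (j %% N)%:R = N%:R - 1 :> R.
    have : (j %% N).+1 = N.
      have := divn_eq j.+1 N; rewrite divnS// modnS dj add1n addn0 mulSn.
      by rewrite {1}(divn_eq j N) -addnS addnC => /eqP; rewrite eqn_add2r => /eqP.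
    by move=> /(congr1 (fun m => m%:R : R)); rewrite -natr1 => <-; rewrite addrK.
  by rewrite e; field.
rewrite add0n -natr1; by field.
Qed.

Lemma refine_grid_le (H_nd : forall k, H k <= H k.+1) j :
  refine_grid j.+1 <= H (j %/ N).+1.
Proof.
rewrite -[leLHS](subrK (refine_grid j)) refine_gridS /refine_grid.
set h := H (j %/ N).+1 - H (j %/ N).
have h0 : 0 <= h by rewrite subr_ge0.
have -> : h / N%:R + (H (j %/ N) + h * (j %% N)%:R / N%:R) =
   H (j %/ N) + h * ((j %% N).+1%:R / N%:R) by rewrite -natr1; field.
rewrite -lerBrDl -/h ler_piMr// ler_pdivrMr ?ltr0n// mul1r ler_nat.
by rewrite ltn_pmod.
Qed.

End time_grid.

Lemma sum_divn (R : realType) (F : nat -> R) (K N : nat) : (0 < N)%N ->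
  \sum_(j < K * N) F (j %/ N)%N = N%:R * \sum_(k < K) F k.
Proof.
move=> N0; elim: K => [|K ih]; first by rewrite !big_ord0 mulr0.
rewrite mulSn addnC big_split_ord/= ih big_ord_recr/= mulrDr; congr (_ + _).
rewrite (eq_bigr (fun=> F K)); last first.
  by move=> i _; rewrite divnMDl// divn_small// addn0.
by rewrite sumr_const card_ord mulr_natl.
Qed.

Section moment.
Context {R : realType} (Pi : {measure set (measurableTypeR R) -> \bar R}).
Hypothesis hPi : unit_levy_measure Pi.
Notation D := (`[-1, 1]%classic : set (measurableTypeR R)).
Context d (T : measurableType d) (P : probability T R) (X : R -> {RV P >-> R}).
Variable gamma : R.
Hypothesis hlevy : levy_process X.
Hypothesis hX : has_triplet X gamma 0 Pi.
Variables (kappa : R) (a : R -> R) (M delta p : R).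
Hypotheses (kappa_ge : 2^-1 <= kappa) (M0 : 0 <= M) (delta0 : 0 < delta) (p0 : 0 < p).
Hypothesis near_a : forall s : seq R, (forall t, t \in s -> 0 < t < delta) ->
  p <= fine (P [set w | forall t, t \in s -> `|X t w - a t| <= M * t `^ kappa]).

Lemma measurable_near (t c r : R) : measurable [set w | `|X t w - c| <= r].
Proof.
rewrite (_ : [set w | _] = X t @^-1` `[c - r, c + r]); first exact: measurable_funPTI.
by apply/seteqP; split => w; rewrite /= in_itv/= ler_distl.
Qed.

(** On the tube at the grid times, each increment is within [2 M t_(j+1) ^ kappa] of the number
    [a t_(j+1) - a t_j]. Independence bounds [p] by a product of such probabilities, and the
    concentration bound does not depend on the centers. The frequency [u j] may vary with the
    step. *)
Lemma increments_bound (n : nat) (t u : nat -> R) :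
  0 < t 0%N -> (forall j, t j <= t j.+1) -> t n < delta ->
  (forall j, 0 <= u j) ->
  (forall j, (j < n)%N -> 4 * (u j * (2 * (M * t j.+1 `^ kappa))) <= 1) ->
  p ^+ 2 <= expR (\sum_(j < n)
    (- ((t j.+1 - t j) / 2 * (levy_sqr Pi (u j) - levy_sqr Pi (4 * u j) / 81)) +
     3 * ((t j.+1 - t j) * levy_sum4 Pi (u j)) ^+ 2)).
Proof.
move=> t0 tnd tn u0 ur.
have tmono i j : (i <= j)%N -> t i <= t j.
  by move: i j; apply/nondecreasing_seqP.
have tpos j : 0 < t j by rewrite (lt_le_trans t0)// tmono.
pose s := [seq t j | j <- iota 0 n.+1].
have hs x : x \in s -> 0 < x < delta.
  move=> /mapP[j]; rewrite mem_iota/= add0n ltnS => jn ->.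
  by rewrite tpos/= (le_lt_trans _ tn)// tmono.
have ts j : (j <= n)%N -> t j \in s.
  by move=> jn; apply: map_f; rewrite mem_iota/= add0n ltnS.
pose c j := a (t j.+1) - a (t j); pose r j := 2 * (M * t j.+1 `^ kappa).
pose B (i : 'I_n) : set R := `[c i - r i, c i + r i]%classic.
pose Y (i : 'I_n) w := X (t i.+1) w - X (t i) w.
have mB i : measurable (B i) by exact: measurable_itv.
have mYB i : measurable (Y i @^-1` B i).
  rewrite -[X in measurable X]setTI; apply: measurable_funB => //.
have PE : P (\bigcap_(i in [set: 'I_n]) (Y i @^-1` B i)) =
    (\prod_(i < n) fine (P (Y i @^-1` B i)))%:E.
  rewrite (levy_indep hlevy (ltW t0) tnd mB).
  elim/big_ind2 : _ => // [x x' y y' -> ->|i _]; first by rewrite EFinM.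
  by rewrite fineK// fin_num_measure//; exact: mYB.
have PYB i : fine (P (Y i @^-1` B i)) ^+ 2 <=
    expR (- ((t i.+1 - t i) / 2 * (levy_sqr Pi (u i) - levy_sqr Pi (4 * u i) / 81)) +
     3 * ((t i.+1 - t i) * levy_sum4 Pi (u i)) ^+ 2).
  rewrite (levy_stationary hlevy (ltW (tpos i)) (tnd i) (mB i)).
  rewrite (_ : _ @^-1` _ = [set w | `|X (t i.+1 - t i) w - c i| <= r i]); last first.
    by apply/seteqP; split => w; rewrite /B/= in_itv/= ler_distl.
  apply: (levy_concentration hPi hX) => //; first by rewrite subr_ge0.
  exact: ur.
apply: (@le_trans _ _ (\prod_(i < n) fine (P (Y i @^-1` B i)) ^+ 2)).
  have q0 : 0 <= \prod_(i < n) fine (P (Y i @^-1` B i)).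
    by apply: prodr_ge0 => i _; rewrite fine_ge0.
  rewrite prodrXl lerXn2r ?nnegrE ?(ltW p0)//.
  apply: (le_trans (near_a hs)); rewrite -lee_fin -PE.
  have mA : measurable [set w | forall x, x \in s -> `|X x w - a x| <= M * x `^ kappa].
    rewrite (_ : [set w | _] = \bigcap_(x in [set` s])
      [set w | `|X x w - a x| <= M * x `^ kappa]); last first.
      by apply/seteqP; split => w /= h x; exact: h.
    apply: fin_bigcap_measurable; first exact: finite_seq.
    by move=> x _; exact: measurable_near.
  rewrite fineK ?fin_num_measure//; apply: le_measure; rewrite ?inE//.
    by apply: fin_bigcap_measurable => // i _; exact: mYB.
  move=> w /= h i _ /=; rewrite /B/= in_itv/= -ler_distl /Y /c /r.
  have := h _ (ts i.+1 (ltn_ord i)); have := h _ (ts i (ltnW (ltn_ord i))).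
  have : t i `^ kappa <= t i.+1 `^ kappa.
    have k0 : 0 <= kappa by rewrite (le_trans _ kappa_ge)// invr_ge0.
    by apply: ge0_ler_powR; rewrite ?nnegrE ?(ltW (tpos _)) ?tnd.
  move=> /(ler_wpM2l M0) h3 h1 h2.
  rewrite (_ : _ - _ = (X (t i.+1) w - a (t i.+1)) - (X (t i) w - a (t i))); last by ring.
  by rewrite (le_trans (ler_normB _ _))//; lra.
by rewrite expR_sum; apply: ler_prod => i _; rewrite sqr_ge0/= PYB.
Qed.

Let alpha := kappa^-1.
(** Ratio of successive block ends; as [q ^ kappa = 1/2], the tube width halves from block to
    block. *)
Let q := 2 `^ (- alpha) : R.

Let kappa0 : 0 < kappa. Proof. by rewrite (lt_le_trans _ kappa_ge)// invr_gt0. Qed.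

Let alpha_itv : 0 < alpha <= 2.
Proof. by rewrite /alpha invr_gt0 kappa0/= invf_ple ?posrE. Qed.

(** The bound [kappa >= 1/2] in the form that later gives [81 q ^ 2 > 1]. *)
Let q_ge : 4^-1 <= q.
Proof.
have -> : 4^-1 = 2 `^ (- 2) :> R by rewrite powRN powR_mulrn// expr2 -natrM.
by apply: ler_powR; [rewrite ler1n|rewrite lerN2; case/andP: alpha_itv].
Qed.

Let q_lt1 : q < 1.
Proof.
case/andP: alpha_itv => a0 _; rewrite /q /powR pnatr_eq0/=.
by rewrite -[ltRHS](@expR0 R) ltr_expR mulNr oppr_lt0 mulr_gt0// ln_gt0// ltr1n.
Qed.

Let q_powR : q `^ kappa = 2^-1.
Proof. by rewrite /q -powRrM mulNr /alpha mulVf ?gt_eqF// powR_inv1. Qed.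

(** Take logarithms in the increment bound over the [N]-fold refined blocks: the linear part does
    not depend on [N], and the quadratic part is [E / N]. Letting [N] grow bounds the linear part by
    [- ln (p ^ 2)], whatever the number of blocks. *)
Lemma weighted_sum_bound : exists K : R, 0 <= K /\ forall n1 : nat,
  \sum_(n < n1) q ^+ n * (levy_sqr Pi (2 ^+ n) - levy_sqr Pi (4 * 2 ^+ n) / 81) <= K.
Proof.
have q0 : 0 < q by rewrite powR_gt0.
have M0' := M0; have d0' := delta0.
(* [tau] is the last grid time: it lies below [delta], and the second bound is the condition
   [4 u r <= 1] with [r = 2 M t ^ kappa] and [u t ^ kappa <= tau ^ kappa]. *)
have [tau [tau0 taud tauM]] : exists tau : R,
    [/\ 0 < tau, tau < delta & 8 * (M * tau `^ kappa) <= 1].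
  pose e := (8 * (M + 1))^-1; have e0 : 0 < e by rewrite invr_gt0; lra.
  exists (Num.min (delta / 2) (e `^ alpha)); split.
  - by rewrite lt_min powR_gt0 // andbT; lra.
  - by rewrite gt_min; apply/orP; left; lra.
  have : Num.min (delta / 2) (e `^ alpha) `^ kappa <= e.
    have ee : (e `^ alpha) `^ kappa = e.
      by rewrite -powRrM mulVf ?gt_eqF// powRr1// ltW.
    rewrite -[leRHS]ee.
    apply: ge0_ler_powR; rewrite ?nnegrE ?powR_ge0 ?(ltW kappa0)//.
      by rewrite le_min powR_ge0 andbT; lra.
    by rewrite ge_min lexx orbT.
  move=> /(ler_wpM2l M0') h; have : M * e <= 8^-1.
    rewrite /e invfM mulrCA ler_piMr ?invr_ge0//.
    by rewrite ler_pdivrMr; lra.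
  by move=> h'; have := le_trans h h'; lra.
have p1 : p <= 1.
  have := @near_a [::]; rewrite (_ : [set w | _] = setT); last first.
    by apply/seteqP; split => w.
  by rewrite probability_setT; apply.
have lnp : 0 <= - ln (p ^+ 2).
  by rewrite oppr_ge0 ln_le0// expr_le1// ltW.
have c0 : 0 < tau * (1 - q) by rewrite mulr_gt0// subr_gt0.
have K0 := divr_ge0 (mulr_ge0 (ler0n R 2) lnp) (ltW c0).
exists (2 * - ln (p ^+ 2) / (tau * (1 - q))); split => //.
case=> [|n1]; first by rewrite big_ord0.
pose G n := levy_sqr Pi (2 ^+ n) - levy_sqr Pi (4 * 2 ^+ n) / 81.
(* Blocks are listed by increasing time, so block [k] carries the frequency [2 ^ (n1 - k)].
   Truncated subtraction freezes [H] at [tau] past the last block, which keeps it monotone at all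
   indices. *)
pose H k := tau * q ^+ (n1.+1 - k).
have H_nd k : H k <= H k.+1.
  rewrite /H ler_pM2l// ler_wiXn2l// ?(ltW q0) ?(ltW q_lt1)//.
  by rewrite leq_sub2l.
pose L k := H k.+1 - H k.
pose E := \sum_(k < n1.+1) 3 * (L k * levy_sum4 Pi (2 ^+ (n1 - k))) ^+ 2.
have E0 : 0 <= E by apply: sumr_ge0 => k _; rewrite mulr_ge0 ?sqr_ge0.
have main N : (0 < N)%N ->
    \sum_(k < n1.+1) L k / 2 * G (n1 - k)%N <= - ln (p ^+ 2) + E / N%:R.
  move=> N0.
  have NR0 : N%:R != 0 :> R by rewrite pnatr_eq0 -lt0n.
  pose t := refine_grid H N; pose u j : R := 2 ^+ (n1 - j %/ N).
  have tS j : t j.+1 - t j = L (j %/ N)%N / N%:R by rewrite /t refine_gridS.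
  have t_nd j : t j <= t j.+1.
    by rewrite -subr_ge0 tS divr_ge0// /L subr_ge0.
  have := @increments_bound (n1.+1 * N)%N t u.
  have -> : t 0%N = H 0%N by rewrite /t refine_grid0.
  have H0 : 0 < H 0%N by rewrite mulr_gt0// exprn_gt0.
  have tn : t (n1.+1 * N)%N < delta.
    rewrite /t /refine_grid mulnK// modnMl mulr0 mul0r addr0 /H subnn expr0 mulr1 //.
  have u0 j : 0 <= u j by rewrite exprn_ge0.
  have ur j : (j < n1.+1 * N)%N -> 4 * (u j * (2 * (M * t j.+1 `^ kappa))) <= 1.
    move=> jn; have kn : (j %/ N < n1.+1)%N by rewrite ltn_divLR.
    have tH : t j.+1 <= H (j %/ N).+1 by exact: refine_grid_le.
    have HE : H (j %/ N).+1 `^ kappa = tau `^ kappa / 2 ^+ (n1 - j %/ N).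
      rewrite /H subSS powRM ?exprn_ge0 ?(ltW tau0) ?(ltW q0)//.
      rewrite -(powR_mulrn _ (ltW q0)) -powRrM [_ * kappa]mulrC powRrM q_powR.
      by rewrite powR_mulrn ?invr_ge0// exprVn.
    have : t j.+1 `^ kappa <= tau `^ kappa / u j.
      rewrite -HE; apply: ge0_ler_powR; rewrite ?nnegrE ?(ltW kappa0)//.
        apply: (@le_trans _ _ (t 0%N)); first by rewrite /t refine_grid0 ltW.
        have t_mono : nondecreasing_seq t by apply/nondecreasing_seqP.
        exact: t_mono.
      by rewrite mulr_ge0 ?exprn_ge0 ?(ltW tau0) ?(ltW q0).
    have up : 0 < u j by rewrite exprn_gt0.
    rewrite ler_pdivlMr// => h.
    have := ler_wpM2l M0 h; lra.
  move=> /(_ H0 t_nd tn u0 ur).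
  rewrite -ler_ln ?posrE ?expR_gt0 ?exprn_gt0// expRK.
  under eq_bigr do rewrite tS.
  pose F k : R := - (L k / N%:R / 2 * G (n1 - k)%N) + 3 * (L k / N%:R * levy_sum4 Pi (2 ^+ (n1 - k))) ^+ 2.
  rewrite (eq_bigr (fun j : 'I_ _ => F (j %/ N)%N)); last by [].
  rewrite sum_divn// /F big_split/= mulrDr sumrN mulrN.
  have -> : N%:R * (\sum_(i < n1.+1) L i / N%:R / 2 * G (n1 - i)%N) = \sum_(k < n1.+1) L k / 2 * G (n1 - k)%N.
    by rewrite mulr_sumr; apply: eq_bigr => i _; field.
  have -> : N%:R * (\sum_(i < n1.+1) 3 * (L i / N%:R * levy_sum4 Pi (2 ^+ (n1 - i))) ^+ 2) = E / N%:R.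
    by rewrite mulr_sumr /E mulr_suml; apply: eq_bigr => i _; field.
  lra.
have sum_le : \sum_(k < n1.+1) L k / 2 * G (n1 - k)%N <= - ln (p ^+ 2).
  apply/ler_addgt0Pr => e e0.
  have hN := archi_boundP (divr_ge0 E0 (ltW e0)).
  set N := Num.bound _ in hN.
  have N0 : (0 < N)%N by rewrite -(ltr0n R) (le_lt_trans _ hN)// divr_ge0// ltW.
  apply: (le_trans (main N N0)); rewrite lerD2l.
  by rewrite ler_pdivrMr ?ltr0n// mulrC -ler_pdivrMr// ltW.
rewrite ler_pdivlMr//.
(* With [n = n1 - k], the block length is [L k = tau * q ^ n * (1 - q)]. *)
have -> : (\sum_(n < n1.+1) q ^+ n * G n) * (tau * (1 - q)) =
    2 * \sum_(k < n1.+1) L k / 2 * G (n1 - k)%N.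
  rewrite [in RHS](reindex_inj rev_ord_inj)/= mulr_suml mulr_sumr.
  apply: eq_bigr => n _; rewrite /L /H subSS.
  have nn : (n <= n1)%N by rewrite -ltnS.
  have e1 : (n1 - (n1 - n) = n)%N by rewrite subKn.
  have e2 : (n1.+1 - (n1 - n) = n.+1)%N by rewrite subSn ?leq_subr// e1.
  by rewrite subSS e1 e2 exprS; field.
by rewrite ler_pM2l.
Qed.

(* Terms two apart in the weighted series cancel up to the factor
   [1 / (81 q ^ 2) < 1]: [(1 - cos) ^ 2] is quartic at the origin and [alpha < 4]. *)
Lemma moment_bound : exists K : R, forall N : nat,
  \sum_(n < N) q ^+ n * levy_sqr Pi (2 ^+ n) <= K.
Proof.
have [K [K0 hK]] := weighted_sum_bound.
have qge := q_ge; have qlt := q_lt1.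
pose S N := \sum_(n < N) q ^+ n * levy_sqr Pi (2 ^+ n).
pose rho := (81 * q ^+ 2)^-1.
have q2 : 16^-1 <= q ^+ 2 by nra.
have q20 : 0 < 81 * q ^+ 2 by lra.
have rho0 : 0 <= rho by rewrite /rho invr_ge0 ltW.
have rho1 : rho < 1 by rewrite /rho invf_lt1//; lra.
(* The crude growth rate is [4 q], from [levy_sqr u <= u ^ 2 * C]. Doubling it makes each new term
   absorbable even when [4 q = 1], and [64 / 81] is still below 1. *)
have rhor : rho * (8 * q) ^+ 2 < 1.
  have -> : rho * (8 * q) ^+ 2 = 64 / 81 by rewrite /rho; field; lra.
  lra.
pose C := \int[Pi]_(x in D) x ^+ 2.
have mD := @measurable_levy_domain R.
have C0 : 0 <= C by apply: Rintegral_ge0 => x _; exact: sqr_ge0.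
have gC u : levy_sqr Pi u <= u ^+ 2 * C.
  rewrite /C -RintegralZl//; last exact: integrable_sqr.
  apply: le_Rintegral => //; first exact: integrable_levy_sqr.
    exact: (integrableZl mD (u ^+ 2) (integrable_sqr hPi)).
  move=> x _; have h0 := onem_cos_ge0 (u * x); have h2 := onem_cos_le2 (u * x).
  by have := onem_cos_le_sqr (u * x); rewrite -exprMn; nra.
have SC N : S N <= C * (8 * q) ^+ N.
  elim: N => [|N ih]; first by rewrite /S big_ord0 mulr_ge0// exprn_ge0//; lra.
  rewrite /S big_ord_recr/= exprS.
  have : q ^+ N * levy_sqr Pi (2 ^+ N) <= C * (8 * q) ^+ N.
    have qN : 0 <= q ^+ N by rewrite exprn_ge0//; lra.
    have : (2 ^+ N) ^+ 2 * C <= 8 ^+ N * C.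
      by rewrite ler_wpM2r// -exprM mulnC exprM lerXn2r ?nnegrE//; lra.
    move=> /(le_trans (gC (2 ^+ N)))/(ler_wpM2l qN).
    by rewrite exprMn; lra.
  have : 0 <= C * (8 * q) ^+ N by rewrite mulr_ge0// exprn_ge0//; lra.
  move: ih; rewrite /S; set s := \sum_(_ < _) _; set v := C * _.
  rewrite mulrCA -/v => h1 h2 h3; nra.
exists (K / (1 - rho)); apply: (@bounded_by_self_improvement _ S K rho C (8 * q)) => //.
- by rewrite rho0.
- by lra.
move=> N; have := hK N; under eq_bigr do rewrite mulrBr.
rewrite sumrB -/(S N) => h.
rewrite {1}(_ : S N = S N - rho * (S N.+2) + rho * S N.+2); last by ring.
rewrite lerD2r; apply: le_trans h; rewrite lerD2l lerN2.
rewrite /S 2!big_ord_recl/= !mulrDr mulr_sumr.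
have g0 n : 0 <= rho * (q ^+ n * levy_sqr Pi (2 ^+ n)).
  by rewrite mulr_ge0// mulr_ge0 ?levy_sqr_ge0// exprn_ge0//; lra.
rewrite addrA -[leLHS]add0r lerD//; first by rewrite addr_ge0 ?g0.
rewrite le_eqVlt; apply/orP; left; apply/eqP; apply: eq_bigr => n _.
rewrite /bump/= !add1n !exprS !mulrA (_ : 2 * 2 = 4 :> R); last by rewrite -natrM.
rewrite /rho; field; lra.
Qed.

(** For each [x], the dyadic series dominates [|x| ^ alpha] as soon as enough scales are included;
    Fatou's lemma transfers the uniform bound on its integrals. *)
Lemma moment_integrable :
  Pi.-integrable D (EFin \o (fun x : R => `|x| `^ alpha)).
Proof.
have [K hK] := moment_bound; have mD := @measurable_levy_domain R.
have c1 := @onem_cos1_gt0 R; have /andP[a0 a2] := alpha_itv.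
pose c : R := 4 / (1 - cos 1) ^+ 2.
have c0 : 0 < c by rewrite divr_gt0// exprn_gt0.
pose h N x : R := \sum_(k < N) c * q ^+ k * (1 - cos (2 ^+ k * x)) ^+ 2.
have ih N := @Rintegral_sum _ (measurableTypeR R) _ Pi D N
  (fun k x => c * q ^+ k * (1 - cos (2 ^+ k * x)) ^+ 2) mD
  (fun k => integrableZl mD (c * q ^+ k) (integrable_levy_sqr hPi (2 ^+ k))).
have mf : measurable_fun D (fun x : R => `|x| `^ alpha).
  apply: measurable_funTS.
  apply: (@measurableT_comp _ _ _ _ _ _ (fun y : R => y `^ alpha) _ (@Num.norm R R)).
    exact: measurable_powR.
  exact: normr_measurable.
have [|//] := @le_Rintegral_of_integral_le _ (measurableTypeR R) _ Pi D
  (fun x : R => `|x| `^ alpha) (c * K) mD mf (fun x _ => powR_ge0 _ _).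
apply: (@ge0_integral_le_of_eventually_le _ _ _ Pi D _ h) => //.
- by move=> n; case: (ih n) => /integrableP[/measurable_EFinP].
- move=> n x _; apply: sumr_ge0 => k _.
  by rewrite mulr_ge0 ?sqr_ge0// mulr_ge0 ?exprn_ge0 ?powR_ge0 ?(ltW c0).
- move=> x; rewrite /= in_itv/= -ler_norml => x1.
  have [->|x0] := eqVneq x 0.
    apply: nearW => n; rewrite normr0 powR0 ?gt_eqF//.
    apply: sumr_ge0 => k _.
    by rewrite mulr_ge0 ?sqr_ge0// mulr_ge0 ?exprn_ge0 ?powR_ge0 ?(ltW c0).
  have ax0 : 0 < `|x| by rewrite normr_gt0.
  have h0 : 0 <= 2 / `|x| by rewrite divr_ge0.
  have := archi_boundP h0; set n0 := Num.bound _ => hn0.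
  exists n0 => // n /= n0n.
  have x2n : 2 < 2 ^+ n * `|x|.
    rewrite -ltr_pdivrMr// (lt_trans hn0)// -natrX ltr_nat.
    by rewrite (leq_ltn_trans n0n)// ltn_expl.
  have := @window_powR R alpha x n; rewrite a0 a2 => /(_ isT).
  have x2 : `|x| <= 2 by lra.
  move=> /(_ x2 x2n); rewrite -ler_pdivlMr ?exprn_gt0//.
  move=> /le_trans; apply; rewrite mulrAC -/c mulr_sumr /h.
  by apply: ler_sum => k _; rewrite mulrA.
- move=> N; have [i e] := ih N; rewrite -EFin_Rintegral// lee_fin e.
  rewrite (eq_bigr (fun k : 'I_N => c * (q ^+ k * levy_sqr Pi (2 ^+ k)))).
    by rewrite -mulr_sumr; apply: ler_wpM2l; [exact: ltW|exact: hK].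
  move=> k _; rewrite RintegralZl//; last exact: integrable_levy_sqr.
  by rewrite mulrA.
Qed.

End moment.

(** * Tightness *)

Lemma geometric_sum_le (R : realType) (r : R) (n : nat) : 0 <= r < 1 ->
  \sum_(k < n) r ^+ k <= (1 - r)^-1.
Proof.
move=> /andP[r0 r1]; elim: n => [|n ih].
  by rewrite big_ord0 invr_ge0 subr_ge0 ltW.
rewrite big_ord_recl expr0 (eq_bigr (fun i : 'I_n => r * r ^+ i)).
  rewrite -mulr_sumr.
  have {1}-> : (1 - r)^-1 = 1 + r * (1 - r)^-1 by field; lra.
  by rewrite lerD2l ler_wpM2l.
by move=> i _; rewrite lift0 exprS.
Qed.

Lemma measurable_norm_ge d (T : measurableType d) (R : realType)
    (P : probability T R) (Y : {RV P >-> R}) (y : R) :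
  measurable [set w | y <= `|Y w|].
Proof.
rewrite (_ : [set w | _] = (Num.norm \o Y) @^-1` `[y, +oo[); last first.
  by apply/seteqP; split => w; rewrite /= in_itv/= andbT.
rewrite -[X in measurable X]setTI.
have mn : measurable_fun setT (Num.norm \o Y).
  by apply: measurableT_comp => //; exact: normr_measurable.
exact: mn.
Qed.

Section tightness.
Context {R : realType} (Pi : {measure set (measurableTypeR R) -> \bar R}).
Hypothesis hPi : unit_levy_measure Pi.
Notation D := (`[-1, 1]%classic : set (measurableTypeR R)).
Context d (T : measurableType d) (P : probability T R) (X : R -> {RV P >-> R}).
Variable gamma : R.
Hypothesis hX : has_triplet X gamma 0 Pi.

(** Damping and oscillation separate: [1 - e c = (1 - e) + e (1 - c)] with
    [e = exp (- t * levy_re u)]. *)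
Lemma expectation_onem_cos_le t u : 0 <= t ->
  \int[P]_w (1 - cos (u * X t w)) <=
  t * levy_re Pi u + (1 - cos (t * levy_im Pi gamma u)).
Proof.
move=> t0; rewrite Rintegral_onem_cos (char_fun_levy hPi hX u t0).1.
have A0 : 0 <= t * levy_re Pi u by rewrite mulr_ge0 ?levy_re_ge0.
set A := t * levy_re Pi u in A0 *; set c := cos _.
have c1 : c <= 1 by exact: cos_le1.
have := expR_ge1Dx (- A); have : expR (- A) <= 1 by rewrite -expR0 ler_expR oppr_le0.
have := expR_gt0 (- A); set e := expR _ => e0 e1 e2.
nra.
Qed.

(** A dyadic truncation inequality: the cosine sum over the scales [2 ^ k y] dominates a multiple of
    the indicator of [y <= |X_t|]. *)
Lemma probability_large_le (t y B : R) : 0 <= t -> 0 < y ->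
  (forall n, \sum_(k < n) \int[P]_w (1 - cos ((2 ^+ k * y)^-1 * X t w)) <= B) ->
  fine (P [set w | y <= `|X t w|]) * (1 - cos 1) <= B.
Proof.
move=> t0 y0 hB; have c1 := @onem_cos1_gt0 R.
set A := [set w | _].
have mA : measurable A by exact: measurable_norm_ge.
pose F k w := (1 - cos 1)^-1 * (1 - cos ((2 ^+ k * y)^-1 * X t w)).
pose h n w := \sum_(k < n) F k w.
have iF k := integrableZl measurableT (1 - cos 1)^-1 (integrable_onem_cos (X t) (2 ^+ k * y)^-1).
have ih n := @Rintegral_sum _ _ _ P setT n F measurableT (fun k => iF k).
have mf : measurable_fun setT (\1_A : T -> R) by exact: measurable_indic.
have F0 k w : 0 <= F k w by rewrite mulr_ge0 ?onem_cos_ge0// invr_ge0 ltW.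
have : (\int[P]_w (\1_A w)%:E <= (B / (1 - cos 1))%:E)%E.
  apply: (@ge0_integral_le_of_eventually_le _ _ _ P setT _ h) => //.
  - by move=> n; case: (ih n) => /integrableP[/measurable_EFinP].
  - by move=> n w _; apply: sumr_ge0.
  - move=> w _; rewrite indicE.
    have [/set_mem wA|_] := boolP (w \in A); last first.
      by apply: nearW => n; apply: sumr_ge0.
    have := archi_boundP (divr_ge0 (normr_ge0 (X t w)) (ltW y0)).
    set n0 := Num.bound _ => hn0.
    exists n0 => // n /= n0n; rewrite /h -mulr_sumr mulrC ler_pdivlMr// mul1r.
    apply: le_trans (@window_onem_cos R (X t w / y) n _) _.
      rewrite normrM [`|y^-1|]ger0_norm ?invr_ge0 ?(ltW y0)//.
      rewrite ler_pdivlMr// mul1r wA/= (lt_trans hn0)// -natrX ltr_nat.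
      by rewrite (leq_ltn_trans n0n)// ltn_expl.
    rewrite le_eqVlt; apply/orP; left; apply/eqP; apply: eq_bigr => k _.
    by rewrite invfM; congr (1 - cos _); ring.
  - move=> n; have [i e] := ih n; rewrite -EFin_Rintegral// lee_fin e.
    rewrite ler_pdivlMr// mulrC mulr_sumr; apply: le_trans (hB n).
    apply: ler_sum => k _; rewrite RintegralZl//; last exact: integrable_onem_cos.
    by rewrite mulrA divff ?mul1r// gt_eqF.
rewrite integral_indic// setIT => h1; rewrite -ler_pdivlMr// -lee_fin.
by rewrite fineK ?fin_num_measure.
Qed.

Variable kappa : R.
Hypothesis kappa_ge : 2^-1 <= kappa.
Let alpha := kappa^-1.
Hypothesis moment : Pi.-integrable D (EFin \o (fun x : R => `|x| `^ alpha)).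

Let kappa0 : 0 < kappa. Proof. by rewrite (lt_le_trans _ kappa_ge)// invr_gt0. Qed.

Let alpha_itv : 0 < alpha <= 2.
Proof. by rewrite /alpha invr_gt0 kappa0/= invf_ple ?posrE. Qed.

Let I := \int[Pi]_(x in D) (`|x| `^ alpha).

Let I0 : 0 <= I. Proof. by apply: Rintegral_ge0 => x _; exact: powR_ge0. Qed.

Lemma levy_re_le_powR u : 0 <= u -> levy_re Pi u <= 2 * I * u `^ alpha.
Proof.
move=> u0; have mD := @measurable_levy_domain R.
rewrite mulrAC -RintegralZl//; apply: le_Rintegral => //.
- exact: integrable_levy_re.
- exact: (integrableZl mD (2 * u `^ alpha) moment).
move=> x _; rewrite -mulrA -powRM//.
have -> : u * `|x| = `|u * x| by rewrite normrM (ger0_norm u0).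
apply: le_trans (min_sqr_le_powR alpha_itv (normr_ge0 (u * x))).
by rewrite real_normK ?num_real// le_min onem_cos_le2 onem_cos_le_sqr.
Qed.

(** Here [alpha >= 1], so the compensated sine is [O(|u x| ^ alpha)]. The linear term is kept: at
    frequencies of order [t ^ (- kappa)] with [kappa <= 1], its product with [t] stays bounded. *)
Lemma levy_im_le_powR_lin u : kappa <= 1 -> 0 <= u ->
  `|levy_im Pi gamma u| <= `|gamma| * u + 2 * I * u `^ alpha.
Proof.
move=> k1 u0; have mD := @measurable_levy_domain R.
have a12 : 1 <= alpha <= 2.
  by case/andP: alpha_itv => _ ->; rewrite andbT /alpha invf_ge1.
rewrite /levy_im (le_trans (ler_normD _ _))// normrM (ger0_norm u0) lerD2l.
apply: (le_trans (le_normr_Rintegral mD (integrable_levy_im hPi u))).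
rewrite mulrAC -RintegralZl//; apply: le_Rintegral => //.
- exact: (integrable_norm (integrable_levy_im hPi u)).
- exact: (integrableZl mD (2 * u `^ alpha) moment).
move=> x _; rewrite -mulrA -powRM//.
have -> : u * `|x| = `|u * x| by rewrite normrM (ger0_norm u0).
apply: le_trans (min_sqr_lin_le_powR a12 (normr_ge0 (u * x))).
by rewrite real_normK ?num_real//; exact: norm_sin_sub_le.
Qed.

Lemma integrable_id : 1 <= kappa -> Pi.-integrable D (EFin \o (fun x : R => x)).
Proof.
move=> k1; apply: (@integrable_of_norm_le _ _ _ Pi D _
  (fun x : measurableTypeR R => `|x : R| `^ alpha)) => //.
move=> x; rewrite /= in_itv/= -ler_norml => x1.
have [->|x0] := eqVneq x 0; first by rewrite normr0 powR_ge0.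
by rewrite ger1_powR ?normr_gt0 ?x0//= /alpha invf_le1.
Qed.

(** With drift zero, [gamma] cancels the compensator and only the integral of [sin (u x)] remains,
    with [|sin (u x)| <= min (1, |u x|)]. *)
Lemma levy_im_le_powR u : 1 <= kappa -> drift gamma Pi = 0 -> 0 <= u ->
  `|levy_im Pi gamma u| <= I * u `^ alpha.
Proof.
move=> k1 drift0 u0; have mD := @measurable_levy_domain R.
have iux := integrableZl mD u (integrable_id k1).
have isux : Pi.-integrable D (EFin \o (fun x : R => sin (u * x))).
  rewrite (_ : _ \o _ = ((EFin \o (fun x : R => sin (u * x) - u * x)%R) \+
     (EFin \o (fun x : R => u * x)%R))%E).
    by apply: integrableD => //; exact: integrable_levy_im.
  by apply/funext => x /=; rewrite -EFinD subrK.
have -> : levy_im Pi gamma u = \int[Pi]_(x in D) sin (u * x).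
  rewrite /levy_im RintegralB// RintegralZl//; last exact: integrable_id.
  by move: drift0; rewrite /drift => /subr0_eq ->; ring.
apply: (le_trans (le_normr_Rintegral mD isux)).
rewrite mulrC -RintegralZl//; apply: le_Rintegral => //.
- exact: (integrable_norm isux).
- exact: (integrableZl mD (u `^ alpha) moment).
move=> x _; rewrite -powRM//.
have -> : u * `|x| = `|u * x| by rewrite normrM (ger0_norm u0).
have a01 : 0 < alpha <= 1 by case/andP: alpha_itv => -> _; rewrite /alpha invf_le1.
apply: le_trans (min_lin_le_powR a01 (normr_ge0 (u * x))).
by rewrite le_min sin_max norm_sin_le.
Qed.

(** At [u = (2 ^ k y t ^ kappa)^-1] the product [t u ^ alpha] no longer depends on [t]; when
    [kappa <= 1] and [t <= 1], also [t u <= 2 ^ (- k) / y]. Both bounds are geometric in [k] and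
    vanish as [y] grows, uniformly in [t]. *)
Lemma exponent_bound : (1 < kappa -> drift gamma Pi = 0) ->
  exists2 C : R, 0 <= C & forall t y k, 0 < t <= 1 -> 1 <= y ->
    \int[P]_w (1 - cos ((2 ^+ k * (y * t `^ kappa))^-1 * X t w)) <=
    C * (2 `^ (- alpha)) ^+ k / y `^ alpha + C * 2^-1 ^+ k / y.
Proof.
move=> drift0.
exists (4 * I + `|gamma|) => [|t y k /andP[t0 t1] y1]; first by rewrite addr_ge0// mulr_ge0.
have y0 : 0 < y by lra.
have tk0 : 0 < t `^ kappa by rewrite powR_gt0.
set u := (2 ^+ k * _)^-1.
have u0 : 0 < u by rewrite invr_gt0 mulr_gt0 ?exprn_gt0// mulr_gt0.
apply: (le_trans (expectation_onem_cos_le u (ltW t0))).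
have h1 := levy_re_le_powR (ltW u0).
have h2 := onem_cos_le_norm (t * levy_im Pi gamma u).
have tu : t * u `^ alpha = (2 `^ (- alpha)) ^+ k / y `^ alpha.
  have v0 : 0 <= 2 ^+ k * (y * t `^ kappa).
    by rewrite mulr_ge0 ?exprn_ge0// mulr_ge0 ?(ltW y0) ?(ltW tk0).
  rewrite /u -(powR_inv1 v0) powRAC powR_inv1 ?powR_ge0//.
  rewrite powRM ?exprn_ge0 ?mulr_ge0 ?(ltW y0) ?(ltW tk0)//.
  rewrite powRM ?powR_ge0 ?(ltW y0)// -(powRrM t) /alpha mulfV ?gt_eqF// powRr1 ?(ltW t0)//.
  rewrite -/alpha -(powR_mulrn k (ler0n R 2)) powRAC powR_mulrn ?powR_ge0// powRN exprVn.
  by field; rewrite !gt_eqF ?powR_gt0 ?exprn_gt0 ?powR_gt0.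
have h3 : t * `|levy_im Pi gamma u| <= 2 * I * (t * u `^ alpha) + `|gamma| * (2^-1 ^+ k / y).
  have [k1|k1] := leP kappa 1.
    have := ler_wpM2l (ltW t0) (levy_im_le_powR_lin k1 (ltW u0)).
    have : t * u <= 2^-1 ^+ k / y.
      rewrite /u mulrA invfM (mulrC t) -mulrA exprVn invfM -mulrA ler_wpM2l ?invr_ge0 ?exprn_ge0//.
      rewrite ler_piMr ?invr_ge0 ?(ltW y0)// mulrC ler_pdivrMr// mul1r.
      by rewrite ger1_powR// t0.
    move=> /(ler_wpM2l (normr_ge0 gamma)); lra.
  have := ler_wpM2l (ltW t0) (levy_im_le_powR (ltW k1) (drift0 k1) (ltW u0)).
  have g0 : 0 <= `|gamma| * (2^-1 ^+ k / y).
    by rewrite mulr_ge0// divr_ge0 ?(ltW y0)// exprn_ge0// invr_ge0.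
  have g1 : 0 <= I * (t * u `^ alpha) by rewrite mulr_ge0// mulr_ge0 ?powR_ge0 ?(ltW t0).
  lra.
move: h2; rewrite normrM (ger0_norm (ltW t0)) => h2.
have h4 := ler_wpM2l (ltW t0) h1.
rewrite -!(mulrA (_ + _)) -tu.
have g0 : 0 <= `|gamma| * (t * u `^ alpha) by rewrite mulr_ge0// mulr_ge0 ?powR_ge0 ?(ltW t0).
have g1 : 0 <= I * (2^-1 ^+ k / y).
  by rewrite mulr_ge0// divr_ge0 ?(ltW y0)// exprn_ge0// invr_ge0.
lra.
Qed.

Lemma levy_tight (p : R) : (1 < kappa -> drift gamma Pi = 0) -> 0 < p ->
  exists2 K : R, 0 < K & forall t, 0 < t <= 1 ->
    fine (P [set w | K * t `^ kappa <= `|X t w|]) < p.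
Proof.
move=> drift0 p0; have [C C0 hC] := exponent_bound drift0.
have c1 := @onem_cos1_gt0 R.
have q1 : 2 `^ (- alpha) < 1 :> R.
  case/andP: alpha_itv => a0 _; rewrite /powR pnatr_eq0/=.
  by rewrite -[ltRHS](@expR0 R) ltr_expR mulNr oppr_lt0 mulr_gt0// ln_gt0// ltr1n.
set q := 2 `^ _ in q1 hC; have q0 : 0 <= q by exact: powR_ge0.
pose A := C * (1 - q)^-1 + C * 2.
have A0 : 0 <= A.
  by rewrite addr_ge0 ?mulr_ge0// invr_ge0 subr_ge0 ltW.
(* [B] is chosen so that [A / B < p (1 - cos 1)]. Since [B >= 1], the value [K = B ^ kappa * B]
   satisfies both [K >= B] and [K ^ alpha >= B], as the two geometric series require. *)
pose B := A / (p * (1 - cos 1)) + 1.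
have B1 : 1 <= B by rewrite lerDr divr_ge0// ltW// mulr_gt0.
have B0 : 0 < B by lra.
pose K := B `^ kappa * B.
have Bk1 : 1 <= B `^ kappa by rewrite -(powRr0 B) ler_powR// ltW.
have KB : B <= K by rewrite ler_peMl// ltW.
have K0 : 0 < K by lra.
have KaB : B <= K `^ alpha.
  rewrite /K powRM ?powR_ge0 ?(ltW B0)// -powRrM /alpha mulfV ?gt_eqF// powRr1 ?(ltW B0)//.
  rewrite ler_peMr ?(ltW B0)// -(powRr0 B) ler_powR//.
  by case/andP: alpha_itv => a0 _; exact: ltW.
exists K => // t t01.
have K1 : 1 <= K by lra.
have t0 : 0 < t by case/andP: t01.
have := @probability_large_le t (K * t `^ kappa) (A / B) (ltW t0) _ _.
rewrite mulr_gt0 ?powR_gt0// => /(_ isT) h.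
rewrite -(ltr_pM2r c1); apply: le_lt_trans (h _) _; last first.
  rewrite ltr_pdivrMr// /B mulrDr mulr1.
  have -> : p * (1 - cos 1) * (A / (p * (1 - cos 1))) = A.
    by field; rewrite !gt_eqF.
  by rewrite ltrDl mulr_gt0.
move=> n; apply: (@le_trans _ _ (\sum_(k < n)
    (C * q ^+ k / K `^ alpha + C * 2^-1 ^+ k / K))).
  by apply: ler_sum => k _; exact: hC.
rewrite big_split/= -!mulr_suml -!mulr_sumr /A mulrDl; apply: lerD.
  apply: ler_pM; rewrite ?invr_ge0 ?(ltW B0)//.
  - by rewrite mulr_ge0// sumr_ge0// => k _; exact: exprn_ge0.
  - exact: powR_ge0.
  - by rewrite ler_wpM2l// geometric_sum_le// q0.
  - by rewrite lef_pV2// posrE// (lt_le_trans B0).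
apply: ler_pM; rewrite ?invr_ge0 ?(ltW K0)//.
- by rewrite mulr_ge0// sumr_ge0// => k _; rewrite exprn_ge0// invr_ge0.
- rewrite ler_wpM2l//.
  rewrite [leRHS](_ : 2 = (1 - 2^-1)^-1); last by field.
  by apply: geometric_sum_le; rewrite invr_ge0 ler0n/= invf_lt1// ltr1n.
- by rewrite lef_pV2// posrE.
Qed.

End tightness.

(** * Bounded variation *)

Section dyadic_variation.
Context {R : realType}.
Implicit Types (f : R -> R) (S : R).

Definition dyadic_variation f S n : R :=
  \sum_(0 <= i < 2 ^ n) `|f (S * i.+1%:R / 2 ^+ n) - f (S * i%:R / 2 ^+ n)|.

Lemma sum_norm_subsequence_le (g : nat -> R) (idx : nat -> nat) (m N : nat) :
  (forall k, (k < m)%N -> (idx k <= idx k.+1)%N) -> (idx m <= N)%N ->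
  \sum_(0 <= k < m) `|g (idx k.+1) - g (idx k)| <= \sum_(0 <= i < N) `|g i.+1 - g i|.
Proof.
move=> idx_le mN.
have step i j : (i <= j)%N -> `|g j - g i| <= \sum_(i <= l < j) `|g l.+1 - g l|.
  by move=> ij; rewrite -(telescope_sumr g ij) ler_norm_sum.
apply: (@le_trans _ _ (\sum_(0 <= i < idx m) `|g i.+1 - g i|)); last first.
  by rewrite [leRHS](big_cat_nat (n := idx m))//= lerDl sumr_ge0.
elim: m idx_le {mN} => [|m ih] idx_le; first by rewrite big_geq// sumr_ge0.
rewrite big_nat_recr//= [leRHS](big_cat_nat (n := idx m))//=; last exact: idx_le.
by apply: lerD; [apply: ih => k km; apply: idx_le; exact: ltnW|exact/step/idx_le].
Qed.

Lemma dyadic_variation_nondecreasing f S n :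
  dyadic_variation f S n <= dyadic_variation f S n.+1.
Proof.
have := @sum_norm_subsequence_le (fun i => f (S * i%:R / 2 ^+ n.+1))
  (fun k => 2 * k)%N (2 ^ n) (2 ^ n.+1).
rewrite /dyadic_variation => h; apply: le_trans (h _ _); last 2 first.
- by move=> k _; rewrite leq_mul2l leqnSn orbT.
- by rewrite expnS.
rewrite le_eqVlt; apply/orP; left; apply/eqP; apply: eq_bigr => k _.
have e j : S * (2 * j)%:R / 2 ^+ n.+1 = S * j%:R / 2 ^+ n.
  by rewrite natrM exprS; field; rewrite expf_neq0.
by rewrite !e.
Qed.

(** Approximating partition points from the right by dyadic points and using right continuity makes
    the variation over any partition a limit of sums bounded by dyadic variations. The gap [t < S]
    leaves room for rounding up. *)
Lemma bounded_variation_of_dyadic f (t S B : R) : 0 <= t < S ->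
  (forall s, 0 <= s -> f x @[x --> s^'+] --> f s) ->
  (forall n, dyadic_variation f S n <= B) -> bounded_variation 0 t f.
Proof.
move=> /andP[t0 tS] fr fB; have S0 : 0 < S by lra.
exists B => _ [s [sp sl] <-].
pose x k := nth t (0 :: s) k.
have x_itv k : (k <= size s)%N -> 0 <= x k <= t.
  move=> ks; rewrite /x itv_partition_nth_ge ?itv_partition_nth_le//.
have x_nd k : (k < size s)%N -> x k <= x k.+1.
  move=> ks; apply/ltW; move: sp => /(pathP t)/(_ k ks); by [].
(* The successor makes the dyadic point strictly larger than [x k], as a right limit demands. *)
pose idx n k := (Num.truncn (2 ^+ n * x k / S)).+1.
pose y n k := S * (idx n k)%:R / 2 ^+ n.
have e0 n : (0 : R) < 2 ^+ n by rewrite exprn_gt0.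
have y_gt n k : x k < y n k.
  have := truncnS_gt (2 ^+ n * x k / S); rewrite -/(idx n k) /y.
  rewrite ltr_pdivrMr// => h; rewrite ltr_pdivlMr//; lra.
have y_le n k : (k <= size s)%N -> y n k <= x k + S / 2 ^+ n.
  move=> ks; have /andP[xk0 _] := x_itv k ks.
  have v0 : 0 <= 2 ^+ n * x k / S by rewrite divr_ge0 ?mulr_ge0// ltW.
  have /andP[+ _] := truncn_itv v0; rewrite ler_pdivlMr// => h.
  rewrite /y /idx -natr1 mulrDr mulr1 mulrDl lerD2r ler_pdivrMr//; lra.
have fy k : (k <= size s)%N -> f (y n k) @[n --> \oo] --> f (x k).
  move=> ks; have /andP[xk0 _] := x_itv k ks.
  move/cvg_at_rightP: (fr _ xk0) => /(_ (y ^~ k)); apply; split => //.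
  apply: (@squeeze_cvgr _ _ _ _ (fun=> x k) (fun n => x k + S / 2 ^+ n)).
  - by apply: nearW => n; rewrite (ltW (y_gt n k)) y_le.
  - exact: cvg_cst.
  rewrite -[X in _ --> X]addr0; apply: cvgD; first exact: cvg_cst.
  rewrite -[X in _ --> X](mulr0 S); apply: cvgMr.
  under eq_fun do rewrite -exprVn.
  by apply: cvg_expr; rewrite ger0_norm ?invr_ge0// invf_lt1// ltr1n.
have cv m : (m <= size s)%N ->
    (\sum_(0 <= k < m) `|f (y n k.+1) - f (y n k)|) @[n --> \oo] -->
    \sum_(0 <= k < m) `|f (x k.+1) - f (x k)|.
  elim: m => [|m ih] ms.
    by rewrite big_geq//; under eq_fun do rewrite big_geq//; exact: cvg_cst.
  rewrite big_nat_recr//=; under eq_fun do rewrite big_nat_recr//=.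
  apply: cvgD; first exact/ih/ltnW.
  by apply: cvg_norm; apply: cvgB; apply: fy => //; exact: ltnW.
apply: (cvgr_to_le (cv _ (leqnn _))); apply: nearW => n.
apply: le_trans (fB n); rewrite /dyadic_variation.
apply: (sum_norm_subsequence_le (fun i => f (S * i%:R / 2 ^+ n))).
  move=> k ks; rewrite ltnS; apply: le_truncn.
  rewrite ler_pM2r ?invr_gt0// ler_pM2l//; exact: x_nd.
have /andP[xs0 xst] := x_itv _ (leqnn (size s)).
rewrite /idx truncn_lt_nat; last by rewrite divr_ge0 ?mulr_ge0 ?(ltW S0) ?(ltW (e0 n)).
by rewrite natrX ltr_pdivrMr// ltr_pM2l// (le_lt_trans xst).
Qed.

End dyadic_variation.

Section bounded_variation_paths.
Context {R : realType} (Pi : {measure set (measurableTypeR R) -> \bar R}).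
Hypothesis hPi : unit_levy_measure Pi.
Notation D := (`[-1, 1]%classic : set (measurableTypeR R)).
Context d (T : measurableType d) (P : probability T R) (X : R -> {RV P >-> R}).
Variable gamma : R.
Hypothesis hlevy : levy_process X.
Hypothesis hX : has_triplet X gamma 0 Pi.
Hypothesis integrable_id : Pi.-integrable D (EFin \o (fun x : R => x)).

Let J := \int[Pi]_(x in D) `|x : R|.

Let J0 : 0 <= J. Proof. by apply: Rintegral_ge0. Qed.

Let integrable_norm_id : Pi.-integrable D (EFin \o (fun x : R => `|x|)).
Proof. exact: (integrable_norm integrable_id). Qed.

Lemma levy_im_le_lin u : 0 <= u -> `|levy_im Pi gamma u| <= (`|gamma| + 2 * J) * u.
Proof.
move=> u0; have mD := @measurable_levy_domain R.
rewrite /levy_im (le_trans (ler_normD _ _))// normrM (ger0_norm u0) mulrDl lerD2l.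
apply: (le_trans (le_normr_Rintegral mD (integrable_levy_im hPi u))).
rewrite mulrAC -RintegralZl//; apply: le_Rintegral => //.
- exact: (integrable_norm (integrable_levy_im hPi u)).
- exact: (integrableZl mD (2 * u) integrable_norm_id).
move=> x _; apply: (le_trans (norm_sin_sub_le _)).
by rewrite ge_min normrM (ger0_norm u0) mulrA lexx orbT.
Qed.

Lemma window_levy_re v n : 0 <= v ->
  \sum_(k < n) 2 ^+ k * levy_re Pi (v / 2 ^+ k) <= 4 * v * J.
Proof.
move=> v0; have mD := @measurable_levy_domain R.
have iF (k : 'I_n) := integrableZl mD (2 ^+ k) (integrable_levy_re hPi (v / 2 ^+ k)).
have [i e] := @Rintegral_sum _ (measurableTypeR R) _ Pi D n
  (fun k x => 2 ^+ k * (1 - cos (v / 2 ^+ k * x))) mD iF.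
have -> : \sum_(k < n) 2 ^+ k * levy_re Pi (v / 2 ^+ k) =
    \sum_(k < n) \int[Pi]_(x in D) (2 ^+ k * (1 - cos (v / 2 ^+ k * x))).
  by apply: eq_bigr => k _; rewrite RintegralZl//; exact: integrable_levy_re.
rewrite -e -RintegralZl//; apply: le_Rintegral => //.
  exact: (integrableZl mD (4 * v) integrable_norm_id).
move=> x _; rewrite -mulrA.
have -> : v * `|x| = `|v * x| by rewrite normrM (ger0_norm v0).
apply: le_trans (window_min n (normr_ge0 (v * x))).
apply: ler_sum => k _; rewrite ler_wpM2l ?exprn_ge0//.
have -> : v / 2 ^+ k * x = v * x / 2 ^+ k by rewrite mulrAC.
rewrite le_min onem_cos_le2/=; apply: (le_trans (onem_cos_le_sqr _)).
by rewrite [in leRHS]exprMn real_normK ?num_real// -exprMn.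
Qed.

(** The linear rate in [t] is the point, since the [2 ^ n] dyadic increments must have bounded total
    mean. A weighted cosine sum dominates [|X_t|] in the limit, and its mean is [O(t)] uniformly in
    the number of scales. *)
Lemma expectation_norm_le : exists2 C : R, 0 <= C & forall t, 0 <= t ->
  (\int[P]_w `|X t w|%:E <= (C * t)%:E)%E.
Proof.
have c1 := @onem_cos1_gt0 R.
pose A := `|gamma| + 2 * J; have A0 : 0 <= A by rewrite addr_ge0// mulr_ge0.
pose c : R := 2 / (1 - cos 1); have c0 : 0 < c by rewrite divr_gt0.
exists (c * (4 * J + 4 * A)) => [|t t0].
  by apply: mulr_ge0; [exact: ltW|apply: addr_ge0; exact: mulr_ge0].
(* With [2 n] scales starting at frequency [2 ^ n], the window covers [2 ^ (- n) <= |X_t| < 2 ^ n],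
   hence eventually every nonzero value. *)
pose u n k : R := 2 ^+ n / 2 ^+ k.
pose F n k w := c / 2 ^+ n * 2 ^+ k * (1 - cos (u n k * X t w)).
pose h n w := \sum_(k < 2 * n) F n k w.
have e0 n : (0 : R) < 2 ^+ n by rewrite exprn_gt0.
have F0 n k w : 0 <= F n k w.
  by rewrite mulr_ge0 ?onem_cos_ge0// mulr_ge0 ?(ltW (e0 _))// divr_ge0 ?(ltW (e0 _))// ltW.
have iF n k := integrableZl measurableT (c / 2 ^+ n * 2 ^+ k) (integrable_onem_cos (X t) (u n k)).
have ih n := @Rintegral_sum _ _ _ P setT (2 * n) (fun k => F n k) measurableT (fun k => iF n k).
apply: (@ge0_integral_le_of_eventually_le _ _ _ P setT (fun w => `|X t w|) h) => //.
- by apply: measurableT_comp => //; exact: normr_measurable.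
- by move=> n; case: (ih n) => /integrableP[/measurable_EFinP].
- by move=> n w _; apply: sumr_ge0.
- move=> w _; have [->|x0] := eqVneq (X t w) 0.
    by apply: nearW => n; rewrite normr0; apply: sumr_ge0.
  have ax0 : 0 < `|X t w| by rewrite normr_gt0.
  have := archi_boundP (ltW ax0); set n1 := Num.bound _ => hn1.
  have ix0 : 0 <= `|X t w|^-1 by rewrite invr_ge0.
  have := archi_boundP ix0; set n2 := Num.bound _ => hn2.
  exists (n1 + n2)%N => // n /= n12.
  have xn : `|X t w| < 2 ^+ n.
    rewrite (lt_trans hn1)// -natrX ltr_nat.
    by rewrite (leq_ltn_trans (leq_trans (leq_addr n2 n1) n12))// ltn_expl.
  have ixn : `|X t w|^-1 < 2 ^+ n.
    rewrite (lt_trans hn2)// -natrX ltr_nat.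
    by rewrite (leq_ltn_trans (leq_trans (leq_addl n1 n2) n12))// ltn_expl.
  have := @window_norm R (2 ^+ n * X t w) (2 * n).
  rewrite normrM (ger0_norm (ltW (e0 n))).
  have -> : 1 <= 2 ^+ n * `|X t w| < 2 ^+ (2 * n).
    rewrite mul2n -addnn exprD ltr_pM2l// xn andbT.
    by move: ixn => /ltW; rewrite -[X in X <= _ -> _]mul1r ler_pdivrMr.
  move=> /(_ isT); rewrite -ler_pdivlMr// -ler_pdivlMl// => /le_trans; apply.
  rewrite le_eqVlt; apply/orP; left; apply/eqP.
  rewrite /h mulrC -mulrA !mulr_sumr !mulr_suml; apply: eq_bigr => k _.
  rewrite /F /u /c (_ : 2 ^+ n * X t w / 2 ^+ k = 2 ^+ n / 2 ^+ k * X t w).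
    by field; rewrite !gt_eqF.
  by rewrite mulrAC.
move=> n; have [i e] := ih n; rewrite -EFin_Rintegral// lee_fin e.
apply: (@le_trans _ _ (\sum_(k < 2 * n) c / 2 ^+ n * (2 ^+ k * (t * levy_re Pi (u n k)) +
   2 ^+ k * Num.min 2 ((t * A * 2 ^+ n / 2 ^+ k) ^+ 2 / 2)))).
  apply: ler_sum => k _; rewrite RintegralZl//; last exact: integrable_onem_cos.
  rewrite -mulrDr -[leLHS]mulrA; apply: ler_wpM2l.
    by rewrite divr_ge0 ?(ltW c0) ?(ltW (e0 _)).
  apply: ler_wpM2l; first exact: ltW.
  apply: (le_trans (expectation_onem_cos_le hPi hX _ t0)); rewrite lerD2l.
  rewrite le_min onem_cos_le2/=; apply: (le_trans (onem_cos_le_sqr _)).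
  rewrite ler_pM2r ?invr_gt0// -(real_normK (num_real (t * _))).
  have un0 : 0 <= u n k by rewrite divr_ge0 ?(ltW (e0 _)).
  rewrite lerXn2r ?nnegrE ?normr_ge0 ?mulr_ge0 ?invr_ge0 ?(ltW (e0 _))//.
  rewrite normrM (ger0_norm t0) -[leRHS]mulrA -[leRHS]mulrA ler_wpM2l//.
  exact: levy_im_le_lin.
rewrite -mulr_sumr big_split/=.
have -> : \sum_(k < 2 * n) 2 ^+ k * (t * levy_re Pi (u n k)) =
    t * \sum_(k < 2 * n) 2 ^+ k * levy_re Pi (2 ^+ n / 2 ^+ k).
  by rewrite mulr_sumr; apply: eq_bigr => k _; rewrite mulrCA.
have w1 := window_levy_re (2 * n) (ltW (e0 n)).
have w2 := @window_min R (t * A * 2 ^+ n) (2 * n) (mulr_ge0 (mulr_ge0 t0 A0) (ltW (e0 n))).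
have := lerD (ler_wpM2l t0 w1) w2 => w12.
apply: le_trans (ler_wpM2l _ w12) _.
  by rewrite divr_ge0 ?(ltW c0) ?(ltW (e0 n)).
rewrite le_eqVlt; apply/orP; left; apply/eqP.
by field; rewrite gt_eqF.
Qed.

Lemma integral_norm_eq_of_law (Y1 Y2 : T -> R) : measurable_fun setT Y1 ->
  measurable_fun setT Y2 ->
  (forall B : set R, measurable B -> P (Y1 @^-1` B) = P (Y2 @^-1` B)) ->
  (\int[P]_w `|Y1 w|%:E = \int[P]_w `|Y2 w|%:E)%E.
Proof.
move=> m1 m2 h.
have mn : measurable_fun (setT : set R) (fun y : R => `|y|%:E).
  by apply/measurable_EFinP; exact: normr_measurable.
have e (Y : T -> R) (mY : measurable_fun setT Y) :
    (\int[P]_w `|Y w|%:E = \int[pushforward P Y]_y `|y|%:E)%E.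
  by rewrite ge0_integral_pushforward.
rewrite (e _ m1) (e _ m2); apply: eq_measure_integral => A mA _.
exact: (h A mA).
Qed.

Lemma expectation_dyadic_variation (S : R) : 0 <= S -> exists2 C : R, 0 <= C &
  forall n, (\int[P]_w (dyadic_variation (fun t => X t w) S n)%:E <= C%:E)%E.
Proof.
move=> S0; have [C C0 hC] := expectation_norm_le.
exists (C * S) => [|n]; first exact: mulr_ge0.
have e0 : (0 : R) < 2 ^+ n by rewrite exprn_gt0.
pose t i : R := S * i%:R / 2 ^+ n.
have t0 i : 0 <= t i by rewrite divr_ge0 ?(ltW e0)// mulr_ge0.
have ti i : t i <= t i.+1.
  by rewrite ler_pM2r ?invr_gt0// ler_wpM2l// ler_nat.
have mX i : measurable_fun setT (fun w => X (t i.+1) w - X (t i) w).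
  exact: measurable_funB.
under eq_integral do rewrite /dyadic_variation -sumEFin.
rewrite ge0_integral_sum//; last 1 first.
  move=> i; apply/measurable_EFinP; apply: measurableT_comp; last exact: mX.
  exact: normr_measurable.
apply: (@le_trans _ _ (\sum_(0 <= i < 2 ^ n) (C * (S / 2 ^+ n))%:E)%E).
  apply: lee_sum => i _.
  have := integral_norm_eq_of_law (mX i) (measurable_funPT _)
    (levy_stationary hlevy (t0 i) (ti i)).
  move=> ->; have -> : S / 2 ^+ n = t i.+1 - t i.
    by rewrite /t -natr1; field; rewrite gt_eqF.
  by apply: hC; rewrite subr_ge0.
rewrite sumEFin lee_fin sumr_const_nat subn0 -[leLHS]mulr_natl natrX.
by rewrite le_eqVlt; apply/orP; left; apply/eqP; field; rewrite gt_eqF.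
Qed.

(** Dyadic variations increase with [n], so by monotone convergence their limit has finite mean and
    is finite almost everywhere. *)
Lemma ae_dyadic_variation_bounded (S : R) : 0 <= S ->
  {ae P, forall w, exists B, forall n, dyadic_variation (fun t => X t w) S n <= B}.
Proof.
move=> S0; have [C C0 hC] := expectation_dyadic_variation S0.
pose V n w := (dyadic_variation (fun t => X t w) S n)%:E.
have V0 n w : (0 <= V n w)%E by rewrite lee_fin sumr_ge0.
have mV n : measurable_fun setT (V n).
  apply/measurable_EFinP; apply: measurable_sum => i.
  apply: measurableT_comp; first exact: normr_measurable.
  exact: measurable_funB.
have ndV w : nondecreasing_seq (V ^~ w).
  by apply/nondecreasing_seqP => n; rewrite lee_fin dyadic_variation_nondecreasing.
have cvV w : cvgn (V ^~ w) by exact: ereal_nondecreasing_is_cvgn.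
have V_lim n w : (V n w <= limn (V ^~ w))%E.
  apply: lime_ge => //; exists n => // m /= nm; exact: ndV.
have mlim : measurable_fun setT (fun w => limn (V ^~ w)).
  by apply: (emeasurable_fun_cvg V) => // w _; exact: cvV.
have ilim : P.-integrable setT (fun w => limn (V ^~ w)).
  apply/integrableP; split => //.
  apply: (@le_lt_trans _ _ C%:E); last exact: ltry.
  rewrite (eq_integral (fun w => limn (V ^~ w))); last first.
    by move=> w _; rewrite gee0_abs// (le_trans (V0 0%N w)).
  rewrite monotone_convergence//; apply: lime_le.
    apply: ereal_nondecreasing_is_cvgn => m n mn.
    by apply: ge0_le_integral => // w _; exact: ndV.
  exact: nearW.
have := integrable_ae measurableT ilim; apply: filterS => w /(_ I) /fineK hw.
by exists (fine (limn (V ^~ w))) => n; rewrite -lee_fin hw V_lim.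
Qed.

Lemma levy_bv_process : bv_process X.
Proof.
(* Integer horizons suffice and are countable, so one null set serves every [t]. *)
have h1 : {ae P, forall w, forall m : nat, exists B, forall n,
    dyadic_variation (fun t => X t w) m.+1%:R n <= B}.
  by apply/ae_foralln => m; exact: ae_dyadic_variation_bounded.
apply: filterS2 h1 (levy_cadlag hlevy) => w h [hr _] t t0.
have [B hB] := h (Num.truncn t).
apply: (bounded_variation_of_dyadic _ hr hB).
by rewrite t0 truncnS_gt.
Qed.

End bounded_variation_paths.

(** * Centering functions *)

Section limsup_at_zero.
Context {R : realType}.
Implicit Type f : R -> R.

(** A single integer controls both the bound and the radius, so the failure of the conclusion is
    covered by countably many tubes. *)
Lemma limf_esup_at_right0_bounded f :
  limf_esup (fun t => (f t)%:E) 0^'+ <> +oo%E ->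
  exists m : nat, forall t, 0 < t < m.+1%:R^-1 -> f t <= m%:R.
Proof.
move=> /eqP; rewrite -ltey => /ereal_inf_lt[_ [V V0 <-] Vy].
have [r hr] : exists r : R, forall t, V t -> f t <= r.
  have ub t : V t -> ((f t)%:E <= ereal_sup [set (f t)%:E | t in V])%E.
    by move=> Vt; apply: ereal_sup_ubound; exists t.
  move: ub Vy; case: (ereal_sup _) => [r ub _|//|ub _].
    by exists r => t /ub; rewrite lee_fin.
  by exists 0 => t /ub; rewrite leeNy_eq.
move: V0 => [e /= e0 hV].
have ie0 : 0 <= e^-1 by rewrite invr_ge0 ltW.
have hm := archi_boundP (normr_ge0 r); have hn := archi_boundP ie0.
exists (Num.bound `|r| + Num.bound e^-1)%N => t /andP[t0 tm].
apply: (le_trans (hr t _)).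
  apply: hV => //=; rewrite sub0r normrN gtr0_norm// (lt_trans tm)//.
  rewrite invf_plt ?posrE//; apply: (lt_le_trans hn).
  by rewrite ler_nat (leq_trans _ (leqnSn _))// leq_addl.
rewrite (le_trans (ler_norm r))// (le_trans (ltW hm))// ler_nat leq_addr//.
Qed.

Lemma limf_esup_at_right0_neqy f (M e : R) : 0 < e ->
  (forall t, 0 < t < e -> f t <= M) ->
  limf_esup (fun t => (f t)%:E) 0^'+ <> +oo%E.
Proof.
move=> e0 fM; apply/eqP; rewrite -ltey.
apply: (@le_lt_trans _ _ M%:E); last exact: ltry.
apply: ereal_inf_le; exists (ereal_sup [set (f t)%:E | t in [set t | 0 < t < e]]).
  exists [set t | 0 < t < e] => //; exists e => //= t.
  by rewrite /= sub0r normrN => te t0; rewrite t0 (le_lt_trans (ler_norm t)).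
by apply: ge_ereal_sup => _ [t /= te <-]; rewrite lee_fin fM.
Qed.

End limsup_at_zero.

Section negligible_tube.
Context d (T : measurableType d) (R : realType) (P : probability T R).
Variables (X : R -> {RV P >-> R}) (kappa : R) (a : R -> R) (M delta : R).

Lemma measurable_finite_tube (s : seq R) :
  measurable [set w | forall t, t \in s -> `|X t w - a t| <= M * t `^ kappa].
Proof.
rewrite (_ : [set w | _] = \bigcap_(t in [set` s])
  [set w | `|X t w - a t| <= M * t `^ kappa]).
  apply: fin_bigcap_measurable; first exact: finite_seq.
  by move=> t _; exact: measurable_near.
by apply/seteqP; split => w /= h t; exact: h.
Qed.

(** If no [p] works, finite sets [s k] have tube probabilities below [1 / (k + 1)]. The intersection
    of these events is measurable and null, and contains the full tube, which is therefore
    negligible even if not measurable. *)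
Lemma tube_negligible_or_probability_ge :
  P.-negligible [set w | forall t, 0 < t < delta -> `|X t w - a t| <= M * t `^ kappa] \/
  exists2 p : R, 0 < p & forall s : seq R, (forall t, t \in s -> 0 < t < delta) ->
    p <= fine (P [set w | forall t, t \in s -> `|X t w - a t| <= M * t `^ kappa]).
Proof.
set E := fun s : seq R => [set w | forall t, t \in s -> `|X t w - a t| <= M * t `^ kappa].
have [hp|hp] := pselect (exists2 p : R, 0 < p & forall s : seq R,
  (forall t, t \in s -> 0 < t < delta) -> p <= fine (P (E s))); [by right|left].
have [s hs] : {s : nat -> seq R & forall k,
    (forall t, t \in s k -> 0 < t < delta) /\ fine (P (E (s k))) < k.+1%:R^-1}.
  apply: (@choice _ _ (fun (k : nat) (s : seq R) => (forall t, t \in s -> 0 < t < delta) /\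
    fine (P (E s)) < k.+1%:R^-1)) => k.
  apply: contrapT => /forallNP h; apply: hp; exists k.+1%:R^-1; first by rewrite invr_gt0.
  by move=> s hs; rewrite leNgt; apply/negP => ps; exact: (h s).
have mE k : measurable (E (s k)) by exact: measurable_finite_tube.
exists (\bigcap_k E (s k)); split.
- exact: bigcap_measurable.
- apply/eqP; rewrite eq_le measure_ge0 andbT; apply/lee_addgt0Pr => e e0.
  have ie0 : 0 <= e^-1 by rewrite invr_ge0 ltW.
  rewrite add0e; have := archi_boundP ie0; set k := Num.bound _ => hk.
  apply: (@le_trans _ _ (P (E (s k)))).
    apply: le_measure; rewrite ?inE//; first exact: bigcap_measurable.
    by apply: bigcap_inf.
  rewrite -[leLHS]fineK ?fin_num_measure// lee_fin (le_trans (ltW (hs k).2))//.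
  rewrite invf_ple ?posrE// (le_trans (ltW hk))// ler_nat//.
- by move=> w h k _ t /(hs k).1; exact: h.
Qed.

End negligible_tube.

Theorem corollary2p1 (d : measure_display) (T : measurableType d)
    (R : realType) (P : probability T R) (X : R -> {RV P >-> R})
    (gamma : R) (Pi : {measure set (measurableTypeR R) -> \bar R})
    (kappa : R)
    (hPi : unit_levy_measure Pi)
    (hX : levy_process X)
    (htriplet : has_triplet X gamma 0 Pi)
    (hdrift : bv_process X -> drift gamma Pi = 0)
    (hkappa : 2^-1 <= kappa)
    (hlimsup : {ae P, forall w,
      limf_esup (fun t : R => (`|X t w| / t `^ kappa)%:E) 0^'+ = +oo%E}) :
  forall a : R -> R,
    {ae P, forall w,
      limf_esup (fun t : R => (`|X t w - a t| / t `^ kappa)%:E) 0^'+ = +oo%E}.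
Proof.
move=> a.
pose tube (m : nat) := [set w | forall t, 0 < t < m.+1%:R^-1 ->
  `|X t w - a t| <= m%:R * t `^ kappa].
apply: (@negligibleS _ _ _ _ (\bigcup_m tube m)).
  move=> w /= /limf_esup_at_right0_bounded[m hm]; exists m => // t tm.
  have tk : 0 < t `^ kappa by rewrite powR_gt0; case/andP: tm.
  by rewrite -ler_pdivrMr// hm.
apply: negligible_bigcup => m.
have delta0 : 0 < m.+1%:R^-1 :> R by rewrite invr_gt0.
have [//|[p p0 hp]] := tube_negligible_or_probability_ge X kappa a m%:R m.+1%:R^-1.
have moment := moment_integrable hPi hX htriplet hkappa (ler0n R m) delta0 p0 hp.
have drift0 : 1 < kappa -> drift gamma Pi = 0.
  move=> k1; apply: hdrift; apply: (levy_bv_process hPi hX htriplet).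
  exact: (integrable_id hkappa moment (ltW k1)).
have [K K0 hK] := levy_tight hPi htriplet hkappa moment drift0 p0.
have a_le t : 0 < t < m.+1%:R^-1 -> `|a t| <= (m%:R + K) * t `^ kappa.
  move=> tm; have /andP[t0 tm1] := tm.
  have t01 : 0 < t <= 1 by rewrite t0 (le_trans (ltW tm1))// invf_le1// ler1n.
  have hs s : s \in [:: t] -> 0 < s < m.+1%:R^-1 by rewrite inE => /eqP ->.
  (* Otherwise the tube event at [t], of probability at least [p], would lie in an event of
     probability below [p]. One such [w] is enough, because [a t] is deterministic. *)
  have [w wE wK] : exists2 w, (forall s, s \in [:: t] ->
      `|X s w - a s| <= m%:R * s `^ kappa) & `|X t w| < K * t `^ kappa.
    apply: contrapT => h; have := lt_le_trans (hK t t01) (hp _ hs).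
    apply/negP; rewrite -leNgt fine_le ?fin_num_measure//.
    + exact: measurable_finite_tube.
    + exact: measurable_norm_ge.
    apply: le_measure; rewrite ?inE//.
    - exact: measurable_finite_tube.
    - exact: measurable_norm_ge.
    - by move=> w wE /=; rewrite leNgt; apply/negP => wK; apply: h; exists w.
  have := wE t; rewrite inE eqxx => /(_ isT) h1.
  rewrite mulrDl (_ : a t = X t w - (X t w - a t)); last by rewrite opprB addrC subrK.
  by rewrite (le_trans (ler_normB _ _))// addrC lerD// ltW.
(* On the tube the bound on [a] gives [|X_t| <= (2 m + K) t ^ kappa] near 0, so the path lies in the
   null event where the limsup of [|X_t| / t ^ kappa] is not infinite. *)
apply: negligibleS hlimsup => w /= wm.
apply: (@limf_esup_at_right0_neqy _ _ (m%:R + (m%:R + K)) m.+1%:R^-1) => // t tm.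
have tk : 0 < t `^ kappa by rewrite powR_gt0; case/andP: tm.
rewrite ler_pdivrMr// mulrDl (_ : X t w = (X t w - a t) + a t); last by rewrite subrK.
by rewrite (le_trans (ler_normD _ _))// lerD ?a_le ?wm.
Qed.
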